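(* Let $H$ and $K$ be complex infinite-dimensional separable Hilbert spaces, and let $A\in B(H)$, $B\in B(K)$. Then $$\bigcap_{C\in \Phi(K,H)}\sigma_{w}(M_{C})=\bigcap_{C\in G(K,H)}\sigma_{w}(M_{C})=\bigcap_{C\in B(K,H)}\sigma_{w}(M_{C})$$ $$=\sigma_{SF+}(A)\cup \sigma_{SF-}(B)\cup\{\lambda\in \mathbb{C}: \alpha(A-\lambda)+\alpha(B-\lambda)\neq\beta(A-\lambda)+\beta(B-\lambda)\}.$$
   Context: $B(H,K)$ is the set of bounded linear operators from $H$ to $K$, and $B(H)=B(H,H)$. For $T\in B(H,K)$, $N(T)$ and $R(T)$ are its kernel and range, $\alpha(T)=\dim N(T)$ and $\beta(T)=\dim (K/R(T))$; any infinite dimension is written $\infty$, i.e. $\alpha(T),\beta(T)\in\{0,1,2,\dots\}\cup\{\infty\}$, with $\infty+n=\infty+\infty=\infty$. $T$ is upper semi-Fredholm if $R(T)$ is closed and $\alpha(T)<\infty$; lower semi-Fredholm if $\beta(T)<\infty$; semi-Fredholm if it is either, in which case $\mathrm{ind}(T)=\alpha(T)-\beta(T)$; Fredholm if it is semi-Fredholm with $\alpha(T)<\infty$ and $\beta(T)<\infty$. $G(K,H)$ and $\Phi(K,H)$ denote the sets of invertible operators and of Fredholm operators from $K$ to $H$. A Weyl operator is a Fredholm operator of index $0$. For an operator $T$ on a Hilbert space: $\sigma_{SF+}(T)$ is the set of $\lambda\in\mathbb{C}$ such that $T-\lambda I$ is not upper semi-Fredholm; $\sigma_{SF-}(T)$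 is the set of $\lambda\in\mathbb{C}$ such that $T-\lambda I$ is not lower semi-Fredholm; $\sigma_w(T)$ is the set of $\lambda\in\mathbb{C}$ such that $T-\lambda I$ is not a Weyl operator. $T-\lambda$ means $T-\lambda I$. For $C\in B(K,H)$, $M_C=\begin{pmatrix}A&C\\0&B\end{pmatrix}\in B(H\oplus K)$, i.e. $M_C(x,y)=(Ax+Cy,By)$. *)

(* Defs.v *)
From HB Require Import structures.
From mathcomp Require Import all_boot all_order all_algebra sesquilinear.
From mathcomp Require Import complex.
From mathcomp Require Import boolp classical_sets functions cardinality reals ereal.
From mathcomp Require Import prodnormedzmodule topology normedtype.

Set Implicit Arguments.
Unset Strict Implicit.
Unset Printing Implicit Defensive.

Import Order.TTheory GRing.Theory Num.Theory.
Import numFieldNormedType.Exports.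

Local Open Scope classical_set_scope.
Local Open Scope ring_scope.

(* The norm of a normed module over R[i] takes its values in R[i]. The inner
   product is linear in its first argument. *)
HB.mixin Record CompleteNormedModule_isHilbert (R : realType) (H : Type)
    of CompleteNormedModule R[i] H := {
  hdot : {dot H for Num.conj} ;
  hdot_norm : forall x : H, hdot x x = `|x| ^+ 2
}.

#[short(type="hilbertType")]
HB.structure Definition Hilbert (R : realType) :=
  {H of CompleteNormedModule R[i] H & CompleteNormedModule_isHilbert R H}.

Definition separable_space (T : topologicalType) :=
  exists2 D : set T, countable D & dense D.

HB.mixin Record isBoundedLinear (K : numFieldType) (V W : normedModType K)
    (T : V -> W) := {
  bounded_linearP : exists M : K, forall x, `|T x| <= M * `|x|
}.

#[short(type="boundedLinear")]
HB.structure Definition BoundedLinear (K : numFieldType)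
    (V W : normedModType K) :=
  {T of isBoundedLinear K V W T & @GRing.Linear K V W *:%R T}.

Notation "''B' ( V , W )" := (boundedLinear V%type W%type)
  (at level 8, format "''B' ( V ,  W )") : type_scope.

Section Operators.
Context {K : numFieldType}.

Section Shift.
Context {V : normedModType K}.

Definition shift_op (T : 'B(V, V)) (lambda : K) (x : V) : V :=
  T x - lambda *: x.

Let shift_linear T lambda : linear (shift_op T lambda).
Proof.
move=> a x y; rewrite /shift_op linearP scalerDr opprD scalerBr.
by rewrite !scalerA (mulrC a) addrACA.
Qed.

HB.instance Definition _ T lambda :=
  GRing.isLinear.Build K V V *:%R (shift_op T lambda) (shift_linear T lambda).

Let shift_bounded T lambda :
  exists M : K, forall x, `|shift_op T lambda x| <= M * `|x|.
Proof.
have [M TM] := @bounded_linearP K V V T.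
exists (M + `|lambda|) => x; rewrite mulrDl (le_trans (ler_normB _ _))//.
by rewrite lerD// normrZ.
Qed.

HB.instance Definition _ T lambda :=
  isBoundedLinear.Build K V V (shift_op T lambda) (shift_bounded T lambda).

End Shift.

Section UpperTriangular.
Context {V W : normedModType K}.

Lemma prod_norm_ge (z : V * W) : `|z.1| <= `|z| /\ `|z.2| <= `|z|.
Proof.
have /andP : (`|z.1| <= `|z|) && (`|z.2| <= `|z|).
  by rewrite -comparable_ge_max ?prod_normE// real_comparable.
by case.
Qed.

(* V * W carries the maximum of the two norms. For Hilbert spaces, this is
   equivalent to the norm of the orthogonal direct sum, whose square is
   `|x| ^+ 2 + `|y| ^+ 2: both give the same bounded operators and the same
   closed sets, hence the same semi-Fredholm operators. *)
Lemma prod_norm_equiv (z : V * W) :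
  `|z| ^+ 2 <= `|z.1| ^+ 2 + `|z.2| ^+ 2 <= 2 * `|z| ^+ 2.
Proof.
have [z1 z2] := prod_norm_ge z; apply/andP; split.
  rewrite prod_normE /Num.max/=; case: ifP => _.
    by rewrite lerDr exprn_ge0.
  by rewrite lerDl exprn_ge0.
by rewrite mulr_natl mulr2n lerD// lerXn2r// nnegrE.
Qed.

Definition upper_triangular_op (A : 'B(V, V)) (B : 'B(W, W)) (C : 'B(W, V))
    (z : V * W) : V * W :=
  (A z.1 + C z.2, B z.2).

Let upper_triangular_linear A B C : linear (upper_triangular_op A B C).
Proof.
move=> a [x1 y1] [x2 y2]; rewrite /upper_triangular_op/=.
congr pair; rewrite !linearP//=.
by rewrite scalerDr addrACA.
Qed.

HB.instance Definition _ A B C :=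
  GRing.isLinear.Build K (V * W)%type (V * W)%type *:%R
    (upper_triangular_op A B C) (upper_triangular_linear A B C).

Let upper_triangular_bounded A B C :
  exists M : K, forall z, `|upper_triangular_op A B C z| <= M * `|z|.
Proof.
have [a Aa] := @bounded_linearP K V V A.
have [b Bb] := @bounded_linearP K W W B.
have [c Cc] := @bounded_linearP K W V C.
have le_abs (M t u r : K) : 0 <= r -> 0 <= t -> t <= u -> r <= M * t ->
    r <= `|M| * u.
  move=> r0 t0 tu rMt; apply: (le_trans rMt).
  rewrite -[leLHS]ger0_norm ?(le_trans r0)// normrM (ger0_norm t0).
  by rewrite ler_wpM2l.
exists (`|a| + `|c| + `|b|) => z; have [z1 z2] := prod_norm_ge z.
have Az := le_abs _ _ _ _ (normr_ge0 _) (normr_ge0 _) z1 (Aa z.1).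
have Bz := le_abs _ _ _ _ (normr_ge0 _) (normr_ge0 _) z2 (Bb z.2).
have Cz := le_abs _ _ _ _ (normr_ge0 _) (normr_ge0 _) z2 (Cc z.2).
rewrite prod_normE/= !mulrDl comparable_ge_max ?real_comparable//.
rewrite (le_trans (ler_normD _ _))/=; last first.
  by rewrite -[leLHS]addr0 lerD ?lerD// mulr_ge0.
by rewrite (le_trans Bz)// lerDr addr_ge0// mulr_ge0.
Qed.

HB.instance Definition _ A B C :=
  isBoundedLinear.Build K (V * W)%type (V * W)%type
    (upper_triangular_op A B C) (upper_triangular_bounded A B C).

End UpperTriangular.

End Operators.

Section Dimension.
Context {R : realType} {V : lmodType R[i]}.

(* For subspaces W `<=` S, the supremum of the sizes of the families of vectors of
   S that are linearly independent modulo W, i.e. dim (S / W), +oo when it is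
   infinite. *)
Definition quotient_dim (S W : set V) : \bar R :=
  ereal_sup [set n%:R%:E | n in [set n : nat |
    exists2 v : 'I_n -> V, (forall i, S (v i)) &
      forall a : 'I_n -> R[i], W (\sum_(i < n) a i *: v i) ->
        forall i, a i = 0]].

Definition set_dim (S : set V) : \bar R := quotient_dim S [set 0].

Definition set_codim (W : set V) : \bar R := quotient_dim setT W.

End Dimension.

Definition infinite_dimensional {R : realType} (V : lmodType R[i]) :=
  set_dim [set: V] = +oo%E.

Section Fredholm.
Context {R : realType} {V W : normedModType R[i]}.
Implicit Types T : 'B(V, W).

Definition nullity T : \bar R := set_dim (T @^-1` [set 0]).

Definition deficiency T : \bar R := set_codim (range T).

Definition upper_semi_fredholm T :=
  closed (range T) /\ (nullity T < +oo)%E.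

Definition lower_semi_fredholm T := (deficiency T < +oo)%E.

Definition semi_fredholm T := upper_semi_fredholm T \/ lower_semi_fredholm T.

(* Meaningful for semi-Fredholm operators only: otherwise it may be +oo - +oo. *)
Definition fredholm_index T : \bar R := (nullity T - deficiency T)%E.

Definition fredholm T :=
  [/\ semi_fredholm T, (nullity T < +oo)%E & (deficiency T < +oo)%E].

Definition weyl T := fredholm T /\ fredholm_index T = 0%E.

Definition invertible T := exists2 S : 'B(W, V), cancel T S & cancel S T.

End Fredholm.

Section Spectra.
Context {R : realType} {V : normedModType R[i]}.
Implicit Types T : 'B(V, V).

Definition sigma_SFp T : set R[i] :=
  [set lambda | ~ upper_semi_fredholm (shift_op T lambda)].

Definition sigma_SFm T : set R[i] :=
  [set lambda | ~ lower_semi_fredholm (shift_op T lambda)].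

Definition sigma_w T : set R[i] :=
  [set lambda | ~ weyl (shift_op T lambda)].

End Spectra.

(* Main.v *)
From HB Require Import structures.
Require Import Defs.
From mathcomp Require Import all_boot all_order all_algebra sesquilinear complex.
From mathcomp Require Import boolp classical_sets functions cardinality.
From mathcomp Require Import reals ereal topology prodnormedzmodule normedtype.
From mathcomp Require Import sequences zify ring.

(** Fix [lambda] and write [A], [B], [T] for [A - lambda], [B - lambda],
    [M_C - lambda]; then [T] is upper triangular with entries [A], [C], [B].
    The operator [C] induces a connecting map
    [delta : N(B) -> H / R(A)], and the exact sequence

      0 -> N(A) -> N(T) -> N(B) -> H / R(A) -> (H * K) / R(T) -> K / R(B) -> 0

    gives, in the extended natural numbers and whatever the rank of [delta],

      alpha(A) + alpha(B) = alpha(T) + rank delta,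
      beta(A) + beta(B) = beta(T) + rank delta.

    If [T] is Weyl, the sequence gives [alpha(A) < oo] and [beta(B) < oo], and the
    identities give the equality of the two sums. It remains to see that [R(A)]
    is closed. The kernel of [delta] has finite dimension, so [R(A)], embedded in
    [H * K], has a complement that is the range of a bounded operator: the image
    under [T] of the orthogonal complement of this kernel, together with finitely
    many vectors. A range with such a complement is closed, by the open mapping
    theorem ([complemented_range_closed], [fredholm_upper_left_closed]).

    Conversely, assume that [R(A)] is closed, that [alpha(A)] and [beta(B)] are
    finite, and that the sums agree. If the sums are finite, every [C] makes [T]
    Weyl, and invertible [C] exist because [H] and [K] both have an orthonormal
    basis indexed by [nat]. Otherwise [alpha(B)] and [beta(A)] are infinite,
    and so are the dimensions of [N(B)], of [R(A)] and of their orthogonal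
    complements. With orthonormal bases of these four spaces, there is an
    isometry from [K] onto [H] that maps [N(B)] onto the complement of [R(A)] up
    to a finite shift, chosen such that [delta] has a kernel of dimension
    [beta(B)] and a cokernel of dimension [alpha(A)]; then
    [alpha(T) = alpha(A) + beta(B) = beta(T)] ([adapted_completion]).

    An invertible [C] is Fredholm, so the three intersections decrease as the
    class of [C] grows. The necessity part, for all bounded [C], and the
    sufficiency part, with an invertible [C], close the circle of
    inclusions. *)

Set Implicit Arguments.
Unset Strict Implicit.
Unset Printing Implicit Defensive.

Import Order.TTheory GRing.Theory Num.Theory.
Import numFieldNormedType.Exports.

Local Open Scope classical_set_scope.
Local Open Scope ring_scope.

(** * Linear subspaces *)

Section LinearSubspaces.
Context {R : realType} {V : lmodType R[i]}.
Implicit Types S W U : set V.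

Definition linear_subspace S :=
  S 0 /\ forall a x y, S x -> S y -> S (a *: x + y).

Lemma subspaceT : linear_subspace [set: V].
Proof. by []. Qed.

Lemma subspace0 : linear_subspace [set 0 : V].
Proof. by split=> // a x y -> ->; rewrite scaler0 addr0. Qed.

Lemma subspaceI S W :
  linear_subspace S -> linear_subspace W -> linear_subspace (S `&` W).
Proof.
by move=> [S0 SP] [W0 WP]; split=> // a x y [Sx Wx] [Sy Wy]; split; auto.
Qed.

Section Closure.
Context {S : set V} (subS : linear_subspace S).

Lemma subspaceD x y : S x -> S y -> S (x + y).
Proof. by move=> Sx Sy; rewrite -[x]scale1r; apply: subS.2. Qed.

Lemma subspaceZ a x : S x -> S (a *: x).
Proof. by move=> Sx; rewrite -[_ *: _]addr0; apply: subS.2 => //; exact: subS.1. Qed.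

Lemma subspaceN x : S x -> S (- x).
Proof. by rewrite -scaleN1r; exact: subspaceZ. Qed.

Lemma subspaceB x y : S x -> S y -> S (x - y).
Proof. by move=> Sx Sy; apply: subspaceD => //; exact: subspaceN. Qed.

Lemma subspace_sum n (a : 'I_n -> R[i]) (v : 'I_n -> V) :
  (forall i, S (v i)) -> S (\sum_(i < n) a i *: v i).
Proof.
move=> Sv; elim/big_ind: _ => [||i _]; first exact: subS.1.
  exact: subspaceD.
exact: subspaceZ.
Qed.

End Closure.

End LinearSubspaces.

Section LinearImages.
Context {R : realType} {V V' : lmodType R[i]} (f : {linear V -> V'}).

Lemma subspace_image (S : set V) : linear_subspace S -> linear_subspace (f @` S).
Proof.
move=> [S0 SP]; split; first by exists 0; rewrite ?linear0.
move=> a _ _ [x Sx <-] [y Sy <-]; exists (a *: x + y); first exact: SP.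
by rewrite linearP.
Qed.

Lemma subspace_preimage (S : set V') :
  linear_subspace S -> linear_subspace (f @^-1` S).
Proof.
move=> [S0 SP]; split=> [|a x y Sx Sy]; first by rewrite /preimage/= linear0.
by rewrite /preimage/= linearP; exact: SP.
Qed.

End LinearImages.

(** * Dimension of a quotient of subspaces *)

Section QuotientDimension.
Context {R : realType} {V : lmodType R[i]}.
Implicit Types S W U : set V.

Definition independent_mod W n (v : 'I_n -> V) :=
  forall a : 'I_n -> R[i], W (\sum_(i < n) a i *: v i) -> forall i, a i = 0.

Definition spanning_mod S W n (v : 'I_n -> V) :=
  forall x, S x -> exists a : 'I_n -> R[i], W (x - \sum_(i < n) a i *: v i).

Lemma quotient_dim_ge S W n (v : 'I_n -> V) :
  (forall i, S (v i)) -> independent_mod W v -> (n%:R%:E <= quotient_dim S W)%E.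
Proof. by move=> Sv Wv; apply: ereal_sup_ubound; exists n => //; exists v. Qed.

(** With fewer spanning vectors than independent ones, the matrix of
    coefficients has a nonzero vector in its left kernel, which is a relation. *)
Lemma independent_spanning_leq S W m n (u : 'I_m -> V) (v : 'I_n -> V) :
  linear_subspace W -> (forall i, S (u i)) -> independent_mod W u ->
  spanning_mod S W v -> (m <= n)%N.
Proof.
move=> subW Su Wu Sv; rewrite leqNgt; apply/negP => nm.
have /choice[c uc] i : exists c : 'I_n -> R[i], W (u i - \sum_j c j *: v j).
  exact/Sv/Su.
pose M := \matrix_(i < m, j < n) c i j.
have : kermx M != 0.
  by rewrite kermx_eq0 /row_free neq_ltn (leq_ltn_trans (rank_leq_col M)).
case/rowV0Pn => a /sub_kermxP aM a0.
have : W (\sum_i a 0 i *: u i).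
  have -> : \sum_i a 0 i *: u i = \sum_i a 0 i *: (u i - \sum_j c i j *: v j).
    under [RHS]eq_bigr do rewrite scalerBr scaler_sumr.
    rewrite sumrB exchange_big/= [X in _ = _ - X]big1 ?subr0// => j _.
    under eq_bigr do rewrite scalerA.
    rewrite -scaler_suml (_ : \sum_i _ = 0) ?scale0r//.
    have /matrixP/(_ 0 j) := aM; rewrite !mxE => aMj.
    rewrite -[RHS]aMj; by apply: eq_bigr => i _; rewrite mxE.
  exact: (subspace_sum subW).
move/Wu => a00; case/negP: a0; apply/eqP/rowP => i.
by rewrite a00 mxE.
Qed.

Lemma quotient_dim_basis S W n (v : 'I_n -> V) : linear_subspace W ->
  (forall i, S (v i)) -> independent_mod W v -> spanning_mod S W v ->
  quotient_dim S W = n%:R%:E.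
Proof.
move=> subW Sv Wv spv; apply/eqP; rewrite eq_le (quotient_dim_ge Sv)// andbT.
apply: ub_ereal_sup => _ [m [u Su Wu] <-].
by rewrite lee_fin ler_nat (independent_spanning_leq subW Su Wu spv).
Qed.

(** A maximal independent family is spanning: a relation between its members and
    one more vector has a nonzero coefficient at that vector. *)
Lemma quotient_dim_spec S W : linear_subspace W ->
  quotient_dim S W = +oo%E \/
  exists n (v : 'I_n -> V), [/\ forall i, S (v i), independent_mod W v,
    spanning_mod S W v & quotient_dim S W = n%:R%:E].
Proof.
move=> subW; pose P n := `[< exists2 v : 'I_n -> V,
  forall i, S (v i) & independent_mod W v >].
have [[N PN]|unbounded] := pselect (exists N, forall n, P n -> (n <= N)%N).
- right; have P0 : exists n, P n.
    by exists 0%N; apply/asboolP; exists (fun=> 0) => [[]|? ? []].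
  have [n /asboolP[v Sv Wv] nmax] := ex_maxnP P0 PN.
  suff spv : spanning_mod S W v.
    by exists n, v; split=> //; exact: quotient_dim_basis.
  move=> x Sx; apply: contrapT => xv.
  suff /nmax : P n.+1 by rewrite ltnn.
  pose u i := if unlift ord0 i is Some j then v j else x.
  apply/asboolP; exists u => [i|a].
    by rewrite /u; case: unliftP.
  rewrite big_ord_recl {1}/u unlift_none.
  under eq_bigr do rewrite /u liftK.
  have [a0|a0] := eqVneq (a ord0) 0.
    rewrite a0 scale0r add0r => /Wv av i.
    by have [j ->|->] := unliftP ord0 i.
  move=> aW; exfalso; apply: xv.
  exists (fun i => - ((a ord0)^-1 * a (lift ord0 i))).
  have := subspaceZ subW (a ord0)^-1 aW.
  rewrite scalerDr scalerA mulVf// scale1r scaler_sumr.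
  under eq_bigr do rewrite scalerA.
  by under [in X in _ -> X]eq_bigr do rewrite scaleNr; rewrite sumrN opprK.
- left; apply/eqyP => r r0.
  have [n Pn rn] : exists2 n, P n & r <= n%:R.
    apply: contrapT => Nr; apply: unbounded; exists (Num.truncn r).+1 => n Pn.
    rewrite leqNgt; apply/negP => rn; apply: Nr; exists n => //.
    apply: ltW; apply: (lt_trans (truncnS_gt r)); first by rewrite ltr_nat.
  have /asboolP[v Sv Wv] := Pn.
  by apply: le_trans (quotient_dim_ge Sv Wv); rewrite lee_fin.
Qed.

Lemma quotient_dim_fin S W : linear_subspace W -> (quotient_dim S W < +oo)%E ->
  exists n (v : 'I_n -> V), [/\ forall i, S (v i), independent_mod W v,
    spanning_mod S W v & quotient_dim S W = n%:R%:E].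
Proof. by move=> subW; have [->|//] := quotient_dim_spec S subW. Qed.

Lemma quotient_dim_ge0 S W : (0 <= quotient_dim S W)%E.
Proof.
by apply: (@quotient_dim_ge S W 0 (fun=> 0)) => [[]//|a _ []].
Qed.

Lemma quotient_dim_sub S S' W W' :
  S `<=` S' -> W' `<=` W -> (quotient_dim S W <= quotient_dim S' W')%E.
Proof.
move=> SS' W'W; apply: ub_ereal_sup => _ [n [v Sv Wv] <-].
by apply: (@quotient_dim_ge _ _ _ v) => [i|a /W'W /Wv]; first exact: SS'.
Qed.

(** Bases of [S] modulo [U] and of [U] modulo [W] together form a basis of [S]
    modulo [W]; if one of them is infinite, so is the left-hand side, because
    the dimension is monotone in [S] and antitone in [W]. *)
Lemma quotient_dim_add S U W : linear_subspace U -> linear_subspace W ->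
  W `<=` U -> U `<=` S ->
  quotient_dim S W = (quotient_dim S U + quotient_dim U W)%E.
Proof.
move=> subU subW WU US.
have inf T T' : (T <= quotient_dim S W)%E -> (0 <= T')%E ->
    T = +oo%E -> (quotient_dim S W = T + T')%E.
  move=> TS T'0 Ty; rewrite Ty addye; last by rewrite gt_eqF// (lt_le_trans _ T'0).
  by apply/eqP; rewrite eq_le leey -Ty.
have [SU|[m [u [Su Uu spu mE]]]] := quotient_dim_spec S subU.
  by apply: inf => //; [exact: quotient_dim_sub|exact: quotient_dim_ge0].
have [UW|[n [v [Uv Wv spv nE]]]] := quotient_dim_spec U subW.
  rewrite addeC; apply: inf => //; first exact: quotient_dim_sub.
  exact: quotient_dim_ge0.
pose w (i : 'I_(m + n)) := match fintype.split i with inl j => u j | inr j => v j end.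
have wl i : w (lshift n i) = u i by rewrite /w (unsplitK (inl i)).
have wr i : w (rshift m i) = v i by rewrite /w (unsplitK (inr i)).
rewrite mE nE -EFinD -natrD; apply: (@quotient_dim_basis _ _ _ w) => //.
- by move=> i; rewrite /w; case: fintype.split => j; [exact: Su|exact/US/Uv].
- move=> a; rewrite big_split_ord/=.
  under eq_bigr do rewrite wl.
  under [X in _ + X]eq_bigr do rewrite wr.
  move=> aW.
  have au : forall i, a (lshift n i) = 0.
    apply: (Uu (fun i => a (lshift n i))).
    rewrite -[X in U X](addrK (\sum_(i < n) a (rshift m i) *: v i)).
    by apply: subspaceB => //; [exact: WU|exact: subspace_sum].
  move: aW; rewrite big1 ?add0r => [/Wv av i|i _]; last by rewrite au scale0r.
  by rewrite -(splitK i); case: fintype.split => j /=; [exact: au|exact: av].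
- move=> x /spu[a /spv[b ab]].
  exists (fun i => match fintype.split i with inl j => a j | inr j => b j end).
  rewrite big_split_ord/= opprD addrA.
  under eq_bigr do rewrite wl (unsplitK (inl _)).
  by under [X in _ - _ - X]eq_bigr do rewrite wr (unsplitK (inr _)).
Qed.

End QuotientDimension.

(** The hypotheses say that [f] induces an isomorphism from [S / W] onto
    [S' / W']; independent families are pushed forward and lifted. *)
Lemma quotient_dim_iso (R : realType) (V V' : lmodType R[i])
    (f : {linear V -> V'}) (S W : set V) (S' W' : set V') :
  linear_subspace S -> linear_subspace W' ->
  (forall x, S x -> S' (f x)) -> (forall x, S x -> W x <-> W' (f x)) ->
  (forall y, S' y -> exists2 x, S x & W' (y - f x)) ->
  quotient_dim S W = quotient_dim S' W'.
Proof.
move=> subS subW' SS' WW' surj; apply/eqP; rewrite eq_le; apply/andP; split.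
- apply: ub_ereal_sup => _ [n [v Sv Wv] <-].
  apply: (@quotient_dim_ge _ _ _ _ _ (f \o v)) => [i|a]; first exact/SS'/Sv.
  move=> aW'; apply: Wv; apply/WW'; first exact: subspace_sum.
  by rewrite linear_sum/=; under eq_bigr do rewrite linearZ.
- apply: ub_ereal_sup => _ [n [v Sv Wv] <-].
  have /choice[u uP] i : exists x, S x /\ W' (v i - f x).
    by have [x] := surj _ (Sv i); exists x.
  apply: (@quotient_dim_ge _ _ _ _ _ u) => [i|a aW]; first exact: (uP i).1.
  apply: Wv; move: aW => /WW' -/(_ (subspace_sum subS _ (fun i => (uP i).1))).
  rewrite linear_sum/= => aW.
  have : W' (\sum_i a i *: (v i - f (u i))).
    by apply: subspace_sum => // i; exact: (uP i).2.
  under [X in W' X -> _]eq_bigr do rewrite scalerBr.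
  rewrite sumrB => /(subspaceD subW')/(_ aW).
  by under [X in _ - _ + X]eq_bigr do rewrite linearZ/=; rewrite subrK.
Qed.

(** * The exact sequence of an upper triangular operator *)

Section PairLeft.
Context {K : numFieldType} {V W : normedModType K}.

Definition pair_left (x : V) : V * W := (x, 0).

Let pair_left_linear : linear pair_left.
Proof. by move=> a x y; congr pair; rewrite /= ?scaler0 ?addr0. Qed.

HB.instance Definition _ :=
  GRing.isLinear.Build K V (V * W)%type *:%R pair_left pair_left_linear.

End PairLeft.

Section UpperTriangularDimensions.
Context {R : realType} {V W : normedModType R[i]}.
Variables (A : 'B(V, V)) (B : 'B(W, W)) (C : 'B(W, V)).
Let T : 'B((V * W)%type, (V * W)%type) := upper_triangular_op A B C.

Let subA : linear_subspace (range A).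
Proof. exact/subspace_image/subspaceT. Qed.

Let subB : linear_subspace (range B).
Proof. exact/subspace_image/subspaceT. Qed.

Let subT : linear_subspace (range T).
Proof. exact/subspace_image/subspaceT. Qed.

Let subNB : linear_subspace (B @^-1` [set 0]).
Proof. exact/subspace_preimage/subspace0. Qed.

(** The kernel of the map [N(B) -> V / R(A)] induced by [C]. *)
Definition connecting_kernel : set W := [set y | B y = 0 /\ range A (C y)].

(** The preimage in [V] of the range of the map [N(B) -> V / R(A)] induced by
    [C]. *)
Definition connecting_range : set V :=
  [set A x + C y | x in [set: V] & y in B @^-1` [set 0]].

Definition connecting_rank : \bar R :=
  quotient_dim (B @^-1` [set 0]) connecting_kernel.

Lemma subspace_connecting_kernel : linear_subspace connecting_kernel.
Proof. exact: (subspaceI subNB (subspace_preimage C subA)). Qed.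

Lemma subspace_connecting_range : linear_subspace connecting_range.
Proof.
split=> [|a _ _ [x _ [y By <-]] [x' _ [y' By' <-]]].
  exists 0 => //; exists 0; first by rewrite /preimage/= linear0.
  by rewrite !linear0 addr0.
exists (a *: x + x') => //; exists (a *: y + y'); first exact: subNB.2.
by rewrite !linearP scalerDr addrACA.
Qed.

(** The projection [(x, y) |-> y] maps [N(T)] onto [connecting_kernel], with
    kernel [N(A) * 0]. *)
Lemma nullity_upper_triangular :
  nullity T = (nullity A + set_dim connecting_kernel)%E.
Proof.
pose N1 : set (V * W) := [set z | A z.1 = 0 /\ z.2 = 0].
have subN1 : linear_subspace N1.
  exact: (subspaceI (subspace_preimage (A \o fst) subspace0)
                    (subspace_preimage snd subspace0)).
have subNT : linear_subspace (T @^-1` [set 0]).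
  exact/subspace_preimage/subspace0.
rewrite /nullity /set_dim (@quotient_dim_add _ _ _ N1)//; last 3 first.
- exact: subspace0.
- by move=> _ ->; split; rewrite ?linear0.
- move=> [x y] [/= Ax ->]; rewrite /preimage/= /T/= /upper_triangular_op/=.
  by rewrite Ax !linear0 addr0.
rewrite addeC; congr (_ + _)%E.
- apply/esym; apply: (@quotient_dim_iso R V (V * W)%type (@pair_left _ V W)
    (A @^-1` [set 0]) [set 0] N1 [set 0]) => //.
  + exact/subspace_preimage/subspace0.
  + exact: subspace0.
  + by move=> x _; split=> [->|[]//]; rewrite linear0.
  + move=> [x y] [/= Ax ->]; exists x => //.
    by rewrite /pair_left subrr.
- apply: (@quotient_dim_iso _ _ _ snd) => //.
  + exact: subspace0.
  + move=> [x y] [/= Axy By]; split=> //; exists (- x) => //.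
    by apply/eqP; rewrite linearN eq_sym -addr_eq0 addrC Axy.
  + move=> [x y] [/= Axy By]; rewrite /N1/=; split=> [[]//|y0].
    by move: Axy; rewrite y0 linear0 addr0.
  + move=> y [By [x _ Ax]]; exists (- x, y); last by rewrite /= subrr.
    rewrite /preimage/= /T/= /upper_triangular_op/= By.
    by rewrite linearN/= Ax addNr.
Qed.

Lemma nullity_lower_right :
  nullity B = (connecting_rank + set_dim connecting_kernel)%E.
Proof.
apply: quotient_dim_add; [exact: subspace_connecting_kernel|exact: subspace0| |].
- by move=> _ ->; split; [exact: linear0|exists 0; rewrite ?linear0].
- by move=> y [].
Qed.

(** Between [R(T)] and the whole space lies [V * R(B)]: the upper quotient is
    [W / R(B)], and [x |-> (x, 0)] identifies the lower one with the cokernel of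
    the connecting map. *)
Lemma deficiency_upper_triangular :
  deficiency T = (deficiency B + set_codim connecting_range)%E.
Proof.
pose U : set (V * W) := [set z | range B z.2].
have subU : linear_subspace U by exact: (subspace_preimage snd subB).
rewrite /deficiency /set_codim (@quotient_dim_add _ _ _ U)//; last first.
  by move=> _ [[x y] _ <-]; exists y.
congr (_ + _)%E.
- apply: (@quotient_dim_iso _ _ _ snd) => //.
  move=> y _; exists (0, y) => //=; rewrite subrr.
  exact: subB.1.
- apply/esym; apply: (@quotient_dim_iso R V (V * W)%type (@pair_left _ V W)
    setT connecting_range U (range T)) => //.
  + by move=> x _; exact: subB.1.
  + move=> h _; split=> [[x _ [y By <-]]|[[x y] _ [<- By]]].
      by exists (x, y) => //; rewrite /T/= /upper_triangular_op/= By.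
    by exists x => //; exists y.
  + move=> [h _] [y _ /= <-]; exists (h - C y) => //.
    exists (0, y) => //; rewrite /T/= /upper_triangular_op/= linear0 add0r.
    by rewrite -[RHS]/(h - (h - C y), B y - 0) subKr subr0.
Qed.

(** The operator [C] identifies the coimage of the connecting map with its image,
    [connecting_range] modulo [R(A)]. *)
Lemma deficiency_upper_left :
  deficiency A = (set_codim connecting_range + connecting_rank)%E.
Proof.
have Asub : range A `<=` connecting_range.
  move=> _ [x _ <-]; exists x => //; exists 0; rewrite /preimage/= ?linear0//.
  by rewrite addr0.
rewrite /deficiency /set_codim.
rewrite (@quotient_dim_add _ _ _ connecting_range)//; last first.
  exact: subspace_connecting_range.
congr (_ + _)%E; apply/esym; apply: (@quotient_dim_iso R W V C
  (B @^-1` [set 0]) connecting_kernel connecting_range (range A)) => //.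
- move=> y By; exists 0 => //; exists y => //.
  by rewrite linear0 add0r.
- by move=> y By; split=> [[]//|].
- move=> _ [x _ [y By <-]]; exists y => //.
  by rewrite addrK; exists x.
Qed.

End UpperTriangularDimensions.

(** * Limits in normed modules *)

Section ComplexReals.
Context {R : realType}.
Implicit Types M e : R[i].

Lemma natr_ge_complex M : 0 <= M -> exists n : nat, M <= n%:R.
Proof.
move=> M0; have /complex_realP[r Mr] := ger0_real M0.
exists (Num.truncn r).+1; rewrite Mr -(rmorph_nat (real_complex R)) lecR.
exact/ltW/truncnS_gt.
Qed.

Lemma geometric_lt M e : 0 <= M -> 0 < e -> exists n, M / 2 ^+ n < e.
Proof.
move=> M0 e0; have [n Mn] := natr_ge_complex (divr_ge0 M0 (ltW e0)).
exists n; rewrite ltr_pdivrMr ?exprn_gt0// -ltr_pdivrMl// mulrC.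
by apply: (le_lt_trans Mn); rewrite -natrX ltr_nat ltn_expl.
Qed.

Lemma pos_lower_bound e e' : 0 < e -> 0 < e' ->
  exists d, [/\ 0 < d, d <= e & d <= e'].
Proof.
move=> e0 e'0; have [ee'|e'e] := real_leP (gtr0_real e0) (gtr0_real e'0).
  by exists e.
by exists e'; split=> //; exact: ltW.
Qed.

End ComplexReals.

Section NormLimits.
Context {R : realType} {X : normedModType R[i]}.
Implicit Types (S : set X) (u : nat -> X).

Definition adherent S (x : X) :=
  forall e : R[i], 0 < e -> exists2 s, S s & `|x - s| < e.

Lemma closed_adherent S : closed S <-> forall x, adherent S x -> S x.
Proof.
split=> [clS x Sx|SS x Sx].
  apply: clS => B /nbhs_ballP[e /= e0 eB].
  have [s Ss xs] := Sx e e0; exists s; split=> //.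
  by apply: eB; rewrite -ball_normE.
apply: SS => e e0; have [s [Ss]] := Sx _ (nbhsx_ballx x e e0).
by rewrite -ball_normE => xs; exists s.
Qed.

Lemma cvg_norm_lt u l e : u @ \oo --> l -> 0 < e ->
  exists N, forall n, (N <= n)%N -> `|l - u n| < e.
Proof.
by move=> /cvgrPdist_lt/[apply] -[N _ Nu]; exists N.
Qed.

Lemma adherent_cvg S u l : u @ \oo --> l -> (forall n, S (u n)) -> adherent S l.
Proof.
move=> ul Su e e0; have [N Nu] := cvg_norm_lt ul e0.
by exists (u N) => //; exact: Nu.
Qed.

Lemma limit_norm_le u l x r N : u @ \oo --> l ->
  (forall n, (N <= n)%N -> `|u n - x| <= r) -> `|l - x| <= r.
Proof.
move=> ul ux; apply/ler_addgt0Pr => e e0.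
have [N' Nu] := cvg_norm_lt ul e0.
have := Nu (maxn N N') (leq_maxr _ _); have := ux (maxn N N') (leq_maxl _ _).
move=> uxr lu; rewrite -(subrK (u (maxn N N')) l) -addrA addrC.
rewrite (le_trans (ler_normD _ _))// lerD//; exact: ltW.
Qed.

End NormLimits.

Lemma bounded_norm (K : numFieldType) (V W : normedModType K) (f : V -> W) :
  (exists M : K, forall x, `|f x| <= M * `|x|) ->
  exists M : K, 0 <= M /\ forall x, `|f x| <= M * `|x|.
Proof.
move=> [M fM]; exists `|M|; split=> // x.
have Mx0 : 0 <= M * `|x| := le_trans (normr_ge0 _) (fM x).
by rewrite -[`|x|]normr_id -normrM ger0_norm.
Qed.

Section GeometricCauchy.
Context {R : realType} {X : completeNormedModType R[i]}.

(** The bound on the tail of the geometric series is kept as a difference, so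
    that it telescopes. *)
Lemma geometric_dist (u : nat -> X) (M : R[i]) n k : 0 <= M ->
  (forall n, `|u n.+1 - u n| <= M / 2 ^+ n) ->
  `|u (n + k)%N - u n| <= (M * 2) / 2 ^+ n.
Proof.
move=> M0 uM.
have : `|u (n + k)%N - u n| <= M * 2 / 2 ^+ n - M * 2 / 2 ^+ (n + k).
  elim: k => [|k IH]; first by rewrite addn0 !subrr normr0.
  rewrite -(subrK (u (n + k)%N) (u _)) -addrA.
  rewrite (le_trans (ler_normD _ _))// addnS.
  apply: le_trans (lerD (uM _) IH) _.
  have P0 : (2 ^+ (n + k) : R[i]) != 0 by rewrite expf_neq0 ?pnatr_eq0.
  have Q0 : (2 ^+ n : R[i]) != 0 by rewrite expf_neq0 ?pnatr_eq0.
  rewrite exprS le_eqVlt; apply/orP; left; apply/eqP.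
  by field; rewrite P0 Q0.
move/le_trans; apply; by rewrite gerBl divr_ge0 ?mulr_ge0 ?exprn_ge0.
Qed.

Lemma geometric_cvg (u : nat -> X) (M : R[i]) : 0 <= M ->
  (forall n, `|u n.+1 - u n| <= M / 2 ^+ n) ->
  exists2 l, u @ \oo --> l & forall n, `|l - u n| <= (M * 2) / 2 ^+ n.
Proof.
move=> M0 uM.
have un n m : (n <= m)%N -> `|u m - u n| <= (M * 2) / 2 ^+ n.
  by move=> nm; rewrite -(subnKC nm); exact: geometric_dist.
have /cauchy_cvg/cvg_ex[l ul] : cauchy (u @ \oo).
  apply/cauchyP => e e0; have [N Ne] := geometric_lt (mulr_ge0 M0 (ler0n _ 2)) e0.
  exists (u N); exists N => // n /= Nn; rewrite -ball_normE/= distrC.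
  exact: (le_lt_trans (un _ _ Nn)).
by exists l => // n; apply: (limit_norm_le ul) => m; exact: un.
Qed.

End GeometricCauchy.

(** * The open mapping theorem *)

(** One member of a countable cover of a complete space is adherent to every point
    of some ball: otherwise nested balls, each one missing one more member,
    would have a common point outside of the cover. *)
Lemma baire_cover (R : realType) (Y : completeNormedModType R[i])
    (F : nat -> set Y) : (forall y, exists n, F n y) ->
  exists n y (r : R[i]), 0 < r /\ forall z, `|z - y| < r -> adherent (F n) z.
Proof.
move=> Fcover; apply: contrapT => meager.
have next (a : nat * (Y * R[i])) : exists b : Y * R[i], 0 < a.2.2 ->
    [/\ 0 < b.2, b.2 *+ 2 <= a.2.2, `|b.1 - a.2.1| <= a.2.2 - b.2 &
        forall s, F a.1 s -> ~ `|b.1 - s| <= b.2].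
  case: a => n [y r] /=; have [r0|r0] := pselect (0 < r); last by exists (y, r).
  have [z [zy [e [e0 ze]]]] : exists z, `|z - y| < r /\
      exists e : R[i], 0 < e /\ forall s, F n s -> ~ `|z - s| < e.
    apply: contrapT => Nz; apply: meager; exists n, y, r; split=> // z zy e e0.
    apply: contrapT => Ns; apply: Nz; exists z; split=> //; exists e; split=> //.
    by move=> s Fs zs; apply: Ns; exists s.
  (* The radius [d / 2] leaves a margin: the closed ball about [z] lies in the
     previous ball and misses [F n], so the limit of the centers does too. *)
  have [d [d0 de dr]] : exists d, [/\ 0 < d, d <= e & d <= r - `|z - y|].
    by apply: pos_lower_bound => //; rewrite subr_gt0.
  exists (z, d / 2) => _ /=.
  have d20 : 0 < d / 2 by rewrite divr_gt0.
  have d2d : d / 2 < d by rewrite ltr_pdivrMr// ltr_pMr// ltr1n.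
  split=> //.
  - rewrite -[X in X <= _]/(d / 2 + d / 2) -splitr (le_trans dr)//.
    by rewrite lerBlDr lerDl.
  - rewrite lerBrDr addrC -lerBrDr (le_trans _ dr)//; exact: ltW.
  - move=> s Fs zs; apply: (ze _ Fs); apply: (le_lt_trans zs).
    exact: (lt_le_trans d2d).
have [next_ nextP] := choice next.
have [y [r [r01 r0 step]]] : exists (y : nat -> Y) (r : nat -> R[i]),
    [/\ r 0%N = 1, forall n, 0 < r n &
      forall n, [/\ r n.+1 *+ 2 <= r n, `|y n.+1 - y n| <= r n - r n.+1 &
        forall s, F n s -> ~ `|y n.+1 - s| <= r n.+1]].
  pose fix yr n : Y * R[i] := if n is m.+1 then next_ (m, yr m) else (0, 1).
  have yr0 n : 0 < (yr n).2.
    elim: n => [|n IH]; first exact: ltr01.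
    by have [] := nextP (n, yr n) IH.
  exists (fun n => (yr n).1), (fun n => (yr n).2); split=> // n.
  by have [] := nextP (n, yr n) (yr0 n).
have rS n : r n <= 1 / 2 ^+ n.
  elim: n => [|n IH]; first by rewrite expr0 divr1 r01.
  have [rr _ _] := step n; rewrite -(mulr_natr (r n.+1)) in rr.
  rewrite ler_pdivlMr ?exprn_gt0// in IH; rewrite ler_pdivlMr ?exprn_gt0//.
  rewrite exprS mulrA; apply: le_trans IH.
  by rewrite ler_wpM2r// exprn_ge0.
have [l yl _] : exists2 l, y @ \oo --> l & forall n, `|l - y n| <= 1 * 2 / 2 ^+ n.
  apply: geometric_cvg => // n; have [_ + _] := step n; move/le_trans; apply.
  by apply: (le_trans _ (rS n)); rewrite gerBl; exact/ltW/r0.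
have yr_dist n k : `|y (n + k)%N - y n| <= r n - r (n + k)%N.
  elim: k => [|k IH]; first by rewrite addn0 !subrr normr0.
  have [_ yy _] := step (n + k)%N.
  rewrite addnS -(subrK (y (n + k)%N) (y _)) -addrA (le_trans (ler_normD _ _))//.
  by apply: le_trans (lerD yy IH) _; rewrite addrC addrA subrK.
have [n Fl] := Fcover l; have [_ _ /(_ l Fl)] := step n; apply.
rewrite distrC; apply: (limit_norm_le yl (N := n.+1)) => m nm.
by rewrite -(subnKC nm) (le_trans (yr_dist _ _))// gerBl; exact/ltW/r0.
Qed.

Section OpenMapping.
Context {R : realType} {X Y : completeNormedModType R[i]}.

(** If [f] is onto, the images of the balls of radius [n] cover [Y]; one of
    them is then dense in a ball, and by linearity in a ball about the origin. *)
Lemma onto_approx_preimage (f : {linear X -> Y}) :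
  (forall y, exists x, f x = y) ->
  exists2 c : R[i], 0 <= c &
    forall y, exists2 x, `|x| <= c * `|y| & `|y - f x| <= `|y| / 2.
Proof.
move=> onto; pose F (n : nat) : set Y := [set f x | x in [set x | `|x| <= n%:R]].
have [|n [y0 [r [r0 rF]]]] := @baire_cover R Y F.
  move=> y; have [x <-] := onto y; have [n xn] := natr_ge_complex (normr_ge0 x).
  by exists n, x.
have ballF y : `|y| < r -> adherent (F (n + n)%N) y.
  move=> yr e e0; have e20 : 0 < e / 2 by rewrite divr_gt0.
  have [|_ [x1 x1n <-] x1e] := rF (y + y0) _ _ e20; first by rewrite addrK.
  have [|_ [x2 x2n <-] x2e] := rF y0 _ _ e20; first by rewrite subrr normr0.
  exists (f (x1 - x2)).
    exists (x1 - x2) => //=; rewrite natrD (le_trans (ler_normB _ _))//.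
    exact: lerD.
  have -> : y - f (x1 - x2) = (y + y0 - f x1) - (y0 - f x2).
    rewrite linearB/= !opprB [RHS](AC (3*2) ((1*(4*3))*(2*5)))/=.
    by rewrite subrr addr0.
  by rewrite (le_lt_trans (ler_normB _ _))// (splitr e) ltrD.
exists (4 * n%:R / r) => [|y]; first by rewrite divr_ge0 ?mulr_ge0// ltW.
have [->|y0'] := eqVneq y 0.
  exists 0; first by rewrite !normr0 mulr0.
  by rewrite linear0 subrr normr0 mul0r.
have ny0 : 0 < `|y| by rewrite normr_gt0.
pose t := r / (`|y| * 2); have t0 : 0 < t by rewrite divr_gt0 ?mulr_gt0.
have tn : `|t| = t by rewrite gtr0_norm.
have [|_ [x xn <-] xe] := ballF (t *: y) _ _ (divr_gt0 (mulr_gt0 t0 ny0) (ltr0n _ 2)).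
  rewrite normrZ tn [X in X < _](_ : _ = r / 2) ?ltr_pdivrMr ?ltr_pMr ?ltr1n//.
  by rewrite /t; field; rewrite gt_eqF.
exists (t^-1 *: x).
  rewrite normrZ normfV tn mulrC ler_pdivrMr// (le_trans xn)//.
  rewrite [leRHS](_ : _ = (n + n)%:R)// /t natrD; field.
  by rewrite !gt_eqF.
have -> : y - f (t^-1 *: x) = t^-1 *: (t *: y - f x).
  by rewrite scalerBr scalerA mulVf ?gt_eqF// scale1r linearZ.
rewrite normrZ normfV tn mulrC ler_pdivrMr// (le_trans (ltW xe))//.
by rewrite le_eqVlt; apply/orP; left; apply/eqP; ring.
Qed.

(** Approximate preimages are corrected repeatedly; the corrections form a
    geometric series, which converges in [X]. *)
Theorem open_mapping (f : {linear X -> Y}) :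
  (exists M : R[i], forall x, `|f x| <= M * `|x|) -> (forall y, exists x, f x = y) ->
  exists2 c : R[i], 0 <= c & forall y, exists2 x, f x = y & `|x| <= c * `|y|.
Proof.
move=> /bounded_norm[M [M0 fM]] /onto_approx_preimage[c c0 approx].
have /choice[phi phiP] y : exists x, `|x| <= c * `|y| /\ `|y - f x| <= `|y| / 2.
  by have [x] := approx y; exists x.
exists (c * 2) => [|y]; first by rewrite mulr_ge0.
(* The error [y - f (s n)] is halved at each step. *)
pose fix s n := if n is m.+1 then s m + phi (y - f (s m)) else 0.
have ys n : `|y - f (s n)| <= `|y| / 2 ^+ n.
  elim: n => [|n IH]; first by rewrite linear0 subr0 expr0 divr1.
  rewrite /= linearD opprD addrA (le_trans (phiP _).2)//.
  by rewrite exprSr invfM mulrA ler_wpM2r// invr_ge0.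
have [|n|l sl l_s] := @geometric_cvg _ _ s (c * `|y|).
- exact: mulr_ge0.
- rewrite /= addrAC subrr add0r (le_trans (phiP _).1)// -mulrA.
  by rewrite ler_wpM2l.
exists l; last first.
  by have := l_s 0%N; rewrite /= subr0 expr0 divr1 mulrAC.
apply/esym/subr0_eq/normr0_eq0/le_anti; rewrite normr_ge0 andbT.
apply/ler_addgt0Pr => e e0; rewrite add0r.
have k0 : 0 <= `|y| + M * (c * `|y| * 2) by rewrite addr_ge0 ?mulr_ge0.
have [n /ltW] := geometric_lt k0 e0; apply: le_trans.
have fsl : `|f (s n) - f l| <= M * (c * `|y| * 2 / 2 ^+ n).
  by rewrite -linearB (le_trans (fM _))// ler_wpM2l// distrC.
have -> : y - f l = (y - f (s n)) + (f (s n) - f l) by rewrite addrA subrK.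
rewrite mulrDl (le_trans (ler_normD _ _))//.
by apply: lerD; [exact: ys|by rewrite (le_trans fsl)// mulrA].
Qed.

End OpenMapping.

HB.instance Definition _ (K : numFieldType) (U V : completeNormedModType K) :=
  Pointed.on (U * V)%type.

Lemma prod_complete (K : numFieldType) (U V : completeNormedModType K)
    (F : set_system (U * V)%type) : ProperFilter F -> cauchy F -> cvg F.
Proof.
move=> PF /cauchyP Fex.
have /cauchy_cvg/cvg_ex[a Fa] : cauchy (fst @ F).
  apply/cauchyP => e e0; have [x Fx] := Fex e e0; exists x.1.
  change (F (fst @^-1` ball x.1 e)); apply: filterS Fx => z.
  rewrite -!ball_normE/=; apply: le_lt_trans.
  by have [] := prod_norm_ge (x - z).
have /cauchy_cvg/cvg_ex[b Fb] : cauchy (snd @ F).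
  apply/cauchyP => e e0; have [x Fx] := Fex e e0; exists x.2.
  change (F (snd @^-1` ball x.2 e)); apply: filterS Fx => z.
  rewrite -!ball_normE/=; apply: le_lt_trans.
  by have [] := prod_norm_ge (x - z).
apply/cvg_ex; exists (a, b) => P [[P1 P2] [/= aP1 bP2] P12].
have F1 : F (fst @^-1` P1) := Fa _ aP1.
have F2 : F (snd @^-1` P2) := Fb _ bP2.
by apply: filterS (filterI F1 F2) => z ?; exact: P12.
Qed.

HB.instance Definition _ (K : numFieldType) (U V : completeNormedModType K) :=
  Uniform_isComplete.Build (U * V)%type (@prod_complete K U V).

(** The range of [A] is closed when it has an algebraic complement that is itself
    the range of a bounded operator [G]. By the open mapping theorem for
    [(x, w) |-> A x + G w], the component in [R(G)] of a limit of points of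
    [R(A)] is arbitrarily small. *)
Lemma complemented_range_closed (R : realType)
    (X1 X2 Y : completeNormedModType R[i])
    (A : {linear X1 -> Y}) (G : {linear X2 -> Y}) :
  (exists M : R[i], forall x, `|A x| <= M * `|x|) ->
  (exists M : R[i], forall x, `|G x| <= M * `|x|) ->
  (forall y, exists x w, y = A x + G w) ->
  (forall x w, A x = G w -> G w = 0) -> closed (range A).
Proof.
move=> /bounded_norm[MA [MA0 AM]] /bounded_norm[MG [MG0 GM]] sum direct.
pose f : {linear (X1 * X2)%type -> Y} := (A \o fst) \+ (G \o snd).
have fE x w : f (x, w) = A x + G w by [].
have [||c c0 fc] := open_mapping (f := f).
- exists (MA + MG) => -[x w]; have [/= xx ww] := prod_norm_ge (x, w).
  change (`|A x + G w| <= (MA + MG) * `|(x, w)|).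
  rewrite (le_trans (ler_normD _ _))// mulrDl lerD//.
    by rewrite (le_trans (AM _))// ler_wpM2l.
  by rewrite (le_trans (GM _))// ler_wpM2l.
- by move=> y; have [x [w ->]] := sum y; exists (x, w).
apply/closed_adherent => z Az; have [x [w zE]] := sum z.
suff Gw : G w = 0 by exists x => //; rewrite zE Gw addr0.
apply/normr0_eq0/le_anti; rewrite normr_ge0 andbT.
apply/ler_addgt0Pr => e e0; rewrite add0r.
have k0 : 0 < MG * c + 1 by rewrite ltr_wpDl ?mulr_ge0.
have [_ [x' _ <-] zx'] := Az _ (divr_gt0 e0 k0).
have [[u v] uvE uvc] := fc (A x' - z).
have /direct : A (x' - x - u) = G (w + v).
  have Auv : A u = A x' - z - G v by rewrite -uvE [f _]fE addrK.
  have -> : A (x' - x - u) = A x' - A x - A u by rewrite !linearB.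
  have -> : G (w + v) = G w + G v by rewrite linearD.
  rewrite Auv zE !opprD !opprK.
  rewrite [LHS](AC (2*((1*2)*1)) ((1*3)*(2*4)*(5*6)))/=.
  by rewrite subrr addNr !add0r.
rewrite linearD => /eqP; rewrite addr_eq0 => /eqP ->; rewrite normrN.
have [_ /= vuv] := prod_norm_ge (u, v).
apply: le_trans (GM v) _; apply: (@le_trans _ _ (MG * (c * (e / (MG * c + 1))))).
  rewrite ler_wpM2l// (le_trans vuv)// (le_trans uvc)// ler_wpM2l// distrC.
  exact: ltW.
rewrite mulrA mulrCA -ler_pdivlMl// mulVf ?gt_eqF// ler_pdivrMr// mul1r.
by rewrite lerDl.
Qed.
(** * The Gram-Schmidt process *)

Section HilbertGeometry.
Context {R : realType} {H : hilbertType R}.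
Local Notation "''[' u , v ]" := (hdot u%R v%R) : ring_scope.
Local Notation "''[' u ]" := '[u, u] : ring_scope.
Implicit Types (x y z : H) (e g : nat -> H) (S : set H).

Lemma hdotC x y : '[x, y] = '[y, x]^*.
Proof. by rewrite [LHS]hermC expr0 mul1r. Qed.

Lemma hdotDl x y z : '[x + y, z] = '[x, z] + '[y, z].
Proof. by rewrite linearDl. Qed.

Lemma hdotBl x y z : '[x - y, z] = '[x, z] - '[y, z].
Proof. by rewrite linearBl. Qed.

Lemma hdotZl a x z : '[a *: x, z] = a * '[x, z].
Proof. by rewrite linearZl_LR. Qed.

Lemma hdot0l z : '[0, z] = 0.
Proof. by rewrite linear0l. Qed.

Lemma hdot_suml n (a : 'I_n -> R[i]) (v : 'I_n -> H) z :
  '[\sum_(i < n) a i *: v i, z] = \sum_(i < n) a i * '[v i, z].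
Proof.
rewrite (big_morph (fun x => '[x, z]) (fun x y => hdotDl x y z) (hdot0l z)).
by under eq_bigr do rewrite hdotZl.
Qed.

Lemma hdot_eq0C x y : '[x, y] = 0 -> '[y, x] = 0.
Proof. by move=> xy; rewrite hdotC xy rmorph0. Qed.

Lemma hdot_eq0 x : '[x] = 0 -> x = 0.
Proof. by move/eqP; rewrite dnorm_eq0 => /eqP. Qed.

Lemma pythagoras x y : '[x, y] = 0 -> `|x + y| ^+ 2 = `|x| ^+ 2 + `|y| ^+ 2.
Proof. by move=> xy; rewrite -!hdot_norm hnormDd. Qed.

Lemma cauchy_schwarz x y : `|'[x, y]| <= `|x| * `|y|.
Proof.
have [->|y0] := eqVneq y 0.
  by rewrite hdotC hdot0l rmorph0 normr0 mulr_ge0.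
have yy : '[y] != 0 by rewrite dnorm_eq0.
pose c := '[x, y] / '[y]; pose z := x - c *: y.
have zy : '[z, y] = 0 by rewrite hdotBl hdotZl divfK ?subrr.
have : `|c *: y| ^+ 2 <= `|x| ^+ 2.
  have zcy : '[z, c *: y] = 0 by rewrite hdotC hdotZl (hdot_eq0C zy) mulr0 rmorph0.
  by rewrite -(subrK (c *: y) x) (pythagoras zcy) lerDr exprn_ge0.
rewrite ler_pXn2r// ?nnegrE// normrZ normrM normfV hdot_norm normrX normr_id.
by rewrite expr2 invfM mulrA mulfVK ?normr_eq0// ler_pdivrMr ?normr_gt0.
Qed.

Lemma subspace_hdot_eq0 z : linear_subspace [set x | '[x, z] = 0].
Proof.
split=> [|a x y /= xz yz]; first by rewrite /= hdot0l.
by rewrite hdotDl hdotZl xz yz mulr0 addr0.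
Qed.

Lemma closed_hdot_eq0 z : closed [set x | '[x, z] = 0].
Proof.
apply/closed_adherent => x xz; apply/normr0_eq0/le_anti; rewrite normr_ge0 andbT.
apply/ler_addgt0Pr => e e0; rewrite add0r.
have z0 : 0 < `|z| + 1 by rewrite ltr_wpDl.
have [s /= sz xs] := xz _ (divr_gt0 e0 z0).
have -> : '[x, z] = '[x - s, z] by rewrite hdotBl sz subr0.
rewrite (le_trans (cauchy_schwarz _ _))//.
rewrite (le_trans (ler_wpM2r (normr_ge0 _) (ltW xs)))//.
by rewrite mulrAC ler_pdivrMr// ler_wpM2l ?(ltW e0)// lerDl.
Qed.

(** Members of the family may vanish, as those that the Gram-Schmidt process
    gives for a vector that depends on the previous ones. *)
Definition orthogonal_system g :=
  (forall i j, i != j -> '[g i, g j] = 0) /\ forall i, g i = 0 \/ '[g i] = 1.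

Definition orthonormal_sequence e := forall i j, '[e i, e j] = (i == j)%:R.

Lemma orthonormal_orthogonal_system e :
  orthonormal_sequence e -> orthogonal_system e.
Proof.
move=> oe; split=> [i j /negPf ij|i]; first by rewrite oe ij.
by right; rewrite oe eqxx.
Qed.

Lemma hdot_residual g y n j : orthogonal_system g -> (j < n)%N ->
  '[y - \sum_(i < n) '[y, g i] *: g i, g j] = 0.
Proof.
move=> [og ng] jn; rewrite hdotBl hdot_suml (bigD1 (Ordinal jn))//= big1 => [|i ij].
  rewrite addr0; have [->|->] := ng j; last by rewrite mulr1 subrr.
  by rewrite [X in X - _]hdotC hdot0l rmorph0 [X in _ - _ * X]hdot0l mulr0 subrr.
by rewrite og ?mulr0//.
Qed.

Section GramSchmidt.
Variable x : nat -> H.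

Let normalize x := `|x|^-1 *: x.

(** The recursion goes through the list of the vectors found so far, since each
    step uses all of them. A zero residual is normalized to zero, because the
    inverse of zero is zero. *)
Fixpoint gram_schmidt_prefix n : seq H :=
  if n is m.+1 then
    rcons (gram_schmidt_prefix m)
      (normalize (x m - \sum_(u <- gram_schmidt_prefix m) '[x m, u] *: u))
  else [::].

Definition gram_schmidt n :=
  normalize (x n - \sum_(u <- gram_schmidt_prefix n) '[x n, u] *: u).

Let residual n := x n - \sum_(i < n) '[x n, gram_schmidt i] *: gram_schmidt i.

Lemma gram_schmidtE n : gram_schmidt n = normalize (residual n).
Proof.
rewrite /gram_schmidt /residual; congr (normalize (_ - _)).
have -> m : gram_schmidt_prefix m = [seq gram_schmidt i | i <- iota 0 m].
  elim: m => // m IH.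
  rewrite -[LHS]/(rcons (gram_schmidt_prefix m) (gram_schmidt m)) IH.
  by rewrite -(addn1 m) iotaD map_cat cats1.
have -> : iota 0 n = index_iota 0 n by rewrite /index_iota subn0.
by rewrite big_map big_mkord.
Qed.

Lemma gram_schmidt_orthogonal : orthogonal_system gram_schmidt.
Proof.
have ng n : gram_schmidt n = 0 \/ '[gram_schmidt n] = 1.
  rewrite gram_schmidtE /normalize; have [->|r0] := eqVneq (residual n) 0.
    by left; rewrite scaler0.
  by right; rewrite hdot_norm normrZ normfV normr_id mulVf ?normr_eq0// expr1n.
have og n j : (j < n)%N -> '[gram_schmidt n, gram_schmidt j] = 0.
  elim/ltn_ind: n j => n IH j jn; rewrite gram_schmidtE hdotZl.
  set a := _^-1; rewrite /residual hdotBl hdot_suml (bigD1 (Ordinal jn))//=.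
  rewrite big1 => [|i ij].
    rewrite addr0; have [->|->] := ng j; last by rewrite mulr1 subrr mulr0.
    by rewrite hdotC hdot0l rmorph0 mul0r subrr mulr0.
  have [lt_ij|lt_ji|ji] := ltngtP i j.
  - by rewrite (hdot_eq0C (IH _ jn _ lt_ij)) mulr0.
  - by rewrite (IH _ (ltn_ord i) _ lt_ji) mulr0.
  - by rewrite -val_eqE/= ji eqxx in ij.
split=> // i j; rewrite neq_ltn => /orP[ij|]; last exact: og.
exact/hdot_eq0C/og.
Qed.

Lemma gram_schmidt_span n : exists a (c : 'I_n -> R[i]),
  x n = a *: gram_schmidt n + \sum_(i < n) c i *: gram_schmidt i.
Proof.
exists `|residual n|, (fun i : 'I_n => '[x n, gram_schmidt i]).
rewrite {1}gram_schmidtE /normalize scalerA.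
have [r0|r0] := eqVneq (residual n) 0.
  by rewrite r0 scaler0 add0r; apply/eqP; rewrite -subr_eq0; apply/eqP.
by rewrite mulfV ?normr_eq0// scale1r subrK.
Qed.

Lemma gram_schmidt_sub S : linear_subspace S -> (forall n, S (x n)) ->
  forall n, S (gram_schmidt n).
Proof.
move=> subS Sx; elim/ltn_ind => n IH; rewrite gram_schmidtE.
apply: (subspaceZ subS); apply: (subspaceB subS) => //.
by apply: (subspace_sum subS) => i; exact: IH.
Qed.

Lemma gram_schmidt_eq0 y n :
  (forall i, (i <= n)%N -> '[y, gram_schmidt i] = 0) -> '[y, x n] = 0.
Proof.
move=> yg; have [a [c ->]] := gram_schmidt_span n; apply: hdot_eq0C.
rewrite hdotDl hdotZl hdot_suml (hdot_eq0C (yg n (leqnn n))) mulr0 add0r.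
by rewrite big1// => i _; rewrite (hdot_eq0C (yg i _)) ?mulr0// ltnW.
Qed.

End GramSchmidt.

End HilbertGeometry.

(** * Orthonormal sequences in a Hilbert space *)

Lemma bounded_sum_tail (R : realType) (a : nat -> R[i]) (M : R[i]) :
  (forall n, 0 <= a n) -> (forall n, \sum_(i < n) a i <= M) ->
  forall e : R[i], 0 < e ->
    exists N, forall n, \sum_(i < n) a i - \sum_(i < N) a i < e.
Proof.
move=> a0 aM e e0.
pose q n := complex.Re (\sum_(i < n) a i).
have aRe n : \sum_(i < n) a i = (q n)%:C%C.
  by rewrite RRe_real// ger0_real// sumr_ge0.
have M0 : 0 <= M by rewrite (le_trans _ (aM 0%N))// big_ord0.
have qM n : q n <= complex.Re M by rewrite -lecR -aRe RRe_real ?ger0_real.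
have q_sup : has_sup (range q).
  by split; [exists (q 0%N), 0%N|exists (complex.Re M) => _ [n _ <-]].
have e_Re : e = (complex.Re e)%:C%C by rewrite RRe_real// gtr0_real.
have Re_e0 : 0 < complex.Re e by rewrite -ltcR -e_Re.
have [_ [N _ <-] Nq] := sup_adherent Re_e0 q_sup.
exists N => n; rewrite aRe [X in _ - X]aRe e_Re -rmorphB ltcR ltrBlDl -ltrBlDr.
apply: le_lt_trans Nq; rewrite lerB//.
by apply: ub_le_sup; [exact: q_sup.2|exists n].
Qed.

Section OrthonormalSequences.
Context {R : realType} {H : hilbertType R}.
Local Notation "''[' u , v ]" := (hdot u%R v%R) : ring_scope.
Local Notation "''[' u ]" := '[u, u] : ring_scope.
Implicit Types (x y z : H) (e g : nat -> H) (S : set H).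

Definition total_in S e := forall y, S y -> (forall n, '[y, e n] = 0) -> y = 0.

(** Points of [S] are chosen near to the points of a dense sequence of the space,
    which need not lie in [S]. They come arbitrarily near to each [y] in [S], but
    the distance from [y] to a point orthogonal to [y] is at least the norm of
    [y]. *)
Lemma total_sequence_exists S : separable_space H -> S 0 ->
  exists x : nat -> H, (forall n, S (x n)) /\ total_in S x.
Proof.
move=> [D cD dD] S0.
have [d dP] : exists d : nat -> H, forall z, D z -> exists n, d n = z.
  move: cD => /pfcard_geP[D0|/unsquash f].
    have [z [_]] := dD setT (ex_intro _ 0 Logic.I) openT.
    by rewrite D0.
  by exists f => z /(@surj _ _ _ _ f)[n _ <-]; exists n.
have /choice[pt ptP] (a : nat * nat) : exists p, S p /\
    forall y, S y -> `|y - d a.1| < 1 / 2 ^+ a.2 -> `|p - d a.1| < 1 / 2 ^+ a.2.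
  have [[y [Sy yd]]|Ny] := pselect (exists y, S y /\ `|y - d a.1| < 1 / 2 ^+ a.2).
    by exists y; split.
  by exists 0; split=> // y Sy yd; exfalso; apply: Ny; exists y.
exists (fun n => pt (odflt (0, 0)%N (unpickle n))); split=> [n|y Sy y_pt].
  exact: (ptP _).1.
apply/normr0_eq0/le_anti; rewrite normr_ge0 andbT.
apply/ler_addgt0Pr => e e0; rewrite add0r.
have [m /ltW] := geometric_lt (ler0n _ 2) e0; apply: le_trans.
have r0 : 0 < 1 / 2 ^+ m :> R[i] by rewrite divr_gt0 ?exprn_gt0.
have [||z [/interior_subset yz /dP[i di]]] := dD (ball y (1 / 2 ^+ m))°.
- by exists y; exact: nbhsx_ballx.
- exact: open_interior.
move: yz; rewrite -ball_normE/= -di => ydi.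
have := (ptP (i, m)).2 _ Sy ydi; have := y_pt (pickle (i, m)).
rewrite pickleK/=; set p := pt _ => yp pdi.
apply: (@le_trans _ _ `|y - p|).
  rewrite -(@ler_pXn2r _ 2)// ?nnegrE// pythagoras ?lerDl ?exprn_ge0//.
  by rewrite hdotC -scaleN1r hdotZl (hdot_eq0C yp) mulr0 rmorph0.
rewrite -(subrK (d i) y) -addrA (le_trans (ler_normD _ _))//.
rewrite (_ : 2 / _ = 1 / 2 ^+ m + 1 / 2 ^+ m); last by rewrite -mulrDl.
by rewrite lerD//; [exact: ltW|rewrite distrC; exact: ltW].
Qed.

(** In a subspace of infinite dimension, infinitely many vectors of the
    Gram-Schmidt process are nonzero; enumerate those. *)
Lemma orthonormal_basis_exists S : separable_space H -> linear_subspace S ->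
  set_dim S = +oo%E ->
  exists e, [/\ orthonormal_sequence e, forall n, S (e n) & total_in S e].
Proof.
move=> sepH subS dimS; have [x [Sx x_total]] := total_sequence_exists sepH subS.1.
pose g := gram_schmidt x; have og : orthogonal_system g.
  exact: gram_schmidt_orthogonal.
have Sg n : S (g n) by exact: gram_schmidt_sub.
have g_total : total_in S g.
  by move=> y Sy yg; apply: x_total => // n; exact: gram_schmidt_eq0.
pose I := [set k | g k != 0].
have infI : ~ finite_set I.
  case/finite_seqP => s Is.
  have [N gN] : exists N, forall k, (N <= k)%N -> g k = 0.
    exists (\max_(k <- s) k).+1 => k; apply: contraTeq => gk.
    have /= ks : k \in s by have : I k := gk; rewrite Is.
    by rewrite -ltnNge ltnS (leq_bigmax_seq (F := id)).
  suff : (set_dim S <= N%:R%:E)%E by rewrite dimS.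
  apply: ub_ereal_sup => _ [n [v Sv iv] <-]; rewrite lee_fin ler_nat.
  apply: (independent_spanning_leq subspace0 Sv iv (v := fun i : 'I_N => g i)).
  move=> y Sy; exists (fun i : 'I_N => '[y, g i]); apply: g_total.
    by apply: (subspaceB subS) => //; exact: (subspace_sum subS).
  move=> j; have [jN|Nj] := ltnP j N; first exact: hdot_residual.
  by rewrite (gN _ Nj) hdotC hdot0l rmorph0.
have /card_esym/card_set_bijP[phi [phiI phi_inj phi_surj]] :=
  eq_card_nat (countableP I) infI.
exists (g \o phi); split=> [i j|n|y Sy yg]; [|exact: Sg|].
- rewrite /=; have [->|ij] := eqVneq i j.
    have [g0|//] := og.2 (phi j); have := phiI j Logic.I.
    by rewrite /I/= g0 eqxx.
  apply: og.1; apply: contra ij => /eqP ij; apply/eqP.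
  by apply: phi_inj => //; rewrite inE.
- apply: g_total => // k; have [->|gk] := eqVneq (g k) 0.
    by rewrite hdotC hdot0l rmorph0.
  by have [n _ <-] := phi_surj k gk; exact: yg.
Qed.

Section Series.
Variables (e : nat -> H) (oe : orthonormal_sequence e).

Lemma hdot_orthonormal_sum (c : nat -> R[i]) n j :
  '[\sum_(i < n) c i *: e i, e j] = if (j < n)%N then c j else 0.
Proof.
rewrite hdot_suml; case: ltnP => [jn|nj].
  rewrite (bigD1 (Ordinal jn))//= oe eqxx mulr1 big1 ?addr0// => i ij.
  by rewrite oe (_ : _ == _ = false) ?mulr0//; exact/negbTE.
rewrite big1// => i _; rewrite oe (_ : _ == _ = false) ?mulr0//.
by rewrite ltn_eqF// (leq_trans (ltn_ord i)).
Qed.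

Lemma hdot_orthonormal_coef n (a : 'I_n -> R[i]) (j : 'I_n) :
  '[\sum_(i < n) a i *: e i, e j] = a j.
Proof.
rewrite hdot_suml (bigD1 j)//= oe eqxx mulr1 big1 ?addr0// => i ij.
by rewrite oe (_ : _ == _ = false) ?mulr0//; exact/negbTE.
Qed.

Lemma norm_orthonormal_sum (c : nat -> R[i]) N k :
  `|\sum_(i < N + k) c i *: e i - \sum_(i < N) c i *: e i| ^+ 2 =
  \sum_(i < N + k) `|c i| ^+ 2 - \sum_(i < N) `|c i| ^+ 2.
Proof.
elim: k => [|k IH]; first by rewrite addn0 !subrr normr0 expr0n.
rewrite addnS !big_ord_recr/= addrAC [RHS]addrAC -IH pythagoras.
  rewrite normrZ (_ : `|e _| = 1) ?mulr1//.
  by apply/eqP; rewrite -sqrp_eq1// -hdot_norm oe eqxx.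
apply: hdot_eq0C; rewrite hdotZl; apply/eqP; rewrite mulf_eq0; apply/orP; right.
by rewrite hdotC hdotBl !hdot_orthonormal_sum ltnn ltnNge leq_addr subrr rmorph0.
Qed.

Lemma bessel x n : \sum_(i < n) `|'[x, e i]| ^+ 2 <= `|x| ^+ 2.
Proof.
pose s := \sum_(i < n) '[x, e i] *: e i.
have <- : `|s| ^+ 2 = \sum_(i < n) `|'[x, e i]| ^+ 2.
  have := norm_orthonormal_sum (fun i => '[x, e i]) 0 n.
  by rewrite !big_ord0 !subr0 add0n.
rewrite -[in leRHS](subrK s x) pythagoras ?lerDr ?exprn_ge0//.
apply: hdot_eq0C; rewrite /s hdot_suml big1// => i _.
rewrite (hdot_eq0C (hdot_residual _ (orthonormal_orthogonal_system oe) (ltn_ord i))).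
by rewrite mulr0.
Qed.

(** The vector is the sum of the series [\sum_i c i *: e i]. Closed subspaces that
    contain the sequence contain the sum: this is what locates projections. *)
Lemma orthonormal_series (c : nat -> R[i]) (r : R[i]) : 0 <= r ->
  (forall n, \sum_(i < n) `|c i| ^+ 2 <= r ^+ 2) ->
  exists x, [/\ forall j, '[x, e j] = c j, `|x| <= r &
    forall S, closed S -> linear_subspace S -> (forall j, S (e j)) -> S x].
Proof.
move=> r0 cr; pose s n := \sum_(i < n) c i *: e i.
have /cauchy_cvg/cvg_ex[x sx] : cauchy (s @ \oo).
  apply/cauchyP => d d0.
  have c0 n : 0 <= `|c n| ^+ 2 by exact: exprn_ge0.
  (* By Pythagoras, the distance between partial sums is controlled by the
     tails of the sum of squares. *)
  have [N Nd] := bounded_sum_tail c0 cr (exprn_gt0 2 d0).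
  exists (s N); exists N => // n /= Nn; rewrite -ball_normE/= distrC.
  rewrite -(@ltr_pXn2r _ 2)// ?nnegrE ?(ltW d0)//.
  by rewrite -(subnKC Nn) norm_orthonormal_sum Nd.
exists x; split=> [j||S clS subS Se].
- apply/subr0_eq/normr0_eq0/le_anti; rewrite normr_ge0 andbT.
  apply/ler_addgt0Pr => d d0; rewrite add0r.
  have [N Ns] := cvg_norm_lt sx d0.
  pose n := maxn N j.+1; have jn : (j < n)%N by rewrite leq_max leqnn orbT.
  have <- : '[s n, e j] = c j by rewrite hdot_orthonormal_sum jn.
  rewrite -hdotBl (le_trans (cauchy_schwarz _ _))//.
  have -> : `|e j| = 1 by apply/eqP; rewrite -sqrp_eq1// -hdot_norm oe eqxx.
  by rewrite mulr1 ltW// Ns// leq_maxl.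
- rewrite -[x]subr0; apply: (limit_norm_le (N := 0) sx) => n _.
  rewrite subr0 -(@ler_pXn2r _ 2)// ?nnegrE//; apply: le_trans (cr n).
  have := norm_orthonormal_sum c 0 n.
  by rewrite !big_ord0 !subr0 add0n /s => ->.
- have /closed_adherent := clS; apply; apply: (adherent_cvg sx) => n.
  exact: (subspace_sum subS).
Qed.

Lemma orthogonal_projection S x : closed S -> linear_subspace S ->
  (forall j, S (e j)) -> exists2 p, S p & forall j, '[x - p, e j] = 0.
Proof.
move=> clS subS Se.
have [p [pe _ /(_ S clS subS Se) Sp]] :=
  orthonormal_series (c := fun j => '[x, e j]) (normr_ge0 x) (bessel x).
by exists p => // j; rewrite hdotBl pe subrr.
Qed.

End Series.

End OrthonormalSequences.

(** The isometry sends [x] to the vector with the same coefficients; totality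
    makes it linear and makes the two constructions inverse to each other. *)
Lemma isometry_exists (R : realType) (K H : hilbertType R)
    (g : nat -> K) (h : nat -> H) :
  orthonormal_sequence g -> total_in setT g ->
  orthonormal_sequence h -> total_in setT h ->
  exists2 U : 'B(K, H), invertible U &
    forall x k, hdot (U x) (h k) = hdot x (g k).
Proof.
(* The same construction, with the roles exchanged, gives the inverse. *)
have half (K' H' : hilbertType R) (g' : nat -> K') (h' : nat -> H') :
    orthonormal_sequence g' -> orthonormal_sequence h' -> total_in setT h' ->
    exists U : 'B(K', H'), forall x k, hdot (U x) (h' k) = hdot x (g' k).
  move=> og oh toth.
  have /choice[U UP] (x : K') : exists z : H',
      (forall j, hdot z (h' j) = hdot x (g' j)) /\ `|z| <= `|x|.
    have [z [zh zx _]] :=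
      orthonormal_series oh (c := fun j => hdot x (g' j)) (normr_ge0 x) (bessel og x).
    by exists z.
  have Ulin : linear U.
    move=> a x y; apply: subr0_eq; apply: toth => // k.
    by rewrite hdotBl hdotDl hdotZl !(UP _).1 hdotDl hdotZl subrr.
  have Ubd : exists M : R[i], forall x, `|U x| <= M * `|x|.
    by exists 1 => x; rewrite mul1r (UP x).2.
  pose lU := GRing.isLinear.Build R[i] K' H' *:%R U Ulin.
  pose bU := isBoundedLinear.Build R[i] K' H' U Ubd.
  pose T : 'B(K', H') := HB.pack U lU bU.
  by exists T => x k; exact: (UP x).1.
move=> og tg oh th; have [U Uh] := half _ _ _ _ og oh th.
have [V Vg] := half _ _ _ _ oh og tg.
exists U => //; exists V => x; apply: subr0_eq.
  by apply: tg => // k; rewrite hdotBl Vg Uh subrr.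
by apply: th => // k; rewrite hdotBl Uh Vg subrr.
Qed.
(** * Closedness of the range of the upper left entry *)

Section NormBounded.
Context {K : numFieldType} {U V W : normedModType K}.

Lemma norm_bounded_comp (f : V -> W) (g : U -> V) :
  (exists M : K, forall x, `|f x| <= M * `|x|) ->
  (exists M : K, forall x, `|g x| <= M * `|x|) ->
  exists M : K, forall x, `|(f \o g) x| <= M * `|x|.
Proof.
move=> /bounded_norm[M [M0 fM]] [N gN]; exists (M * N) => x.
by rewrite (le_trans (fM _))// -mulrA ler_wpM2l.
Qed.

Lemma norm_bounded_add (f g : V -> W) :
  (exists M : K, forall x, `|f x| <= M * `|x|) ->
  (exists M : K, forall x, `|g x| <= M * `|x|) ->
  exists M : K, forall x, `|(f \+ g) x| <= M * `|x|.
Proof.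
move=> [M fM] [N gN]; exists (M + N) => x.
by rewrite (le_trans (ler_normD _ _))// mulrDl lerD.
Qed.

Lemma prod_norm_le (z : V * W) : `|z| <= `|z.1| + `|z.2|.
Proof.
by rewrite prod_normE /Num.max/=; case: ifP => _; rewrite ?lerDl ?lerDr.
Qed.

End NormBounded.

Section PairRight.
Context {K : numFieldType} {V W : normedModType K}.

Definition pair_right (y : W) : V * W := (0, y).

Let pair_right_linear : linear pair_right.
Proof. by move=> a x y; congr pair; rewrite /= ?scaler0 ?addr0. Qed.

HB.instance Definition _ :=
  GRing.isLinear.Build K W (V * W)%type *:%R pair_right pair_right_linear.

Lemma pair_right_bounded : exists M : K, forall y, `|pair_right y| <= M * `|y|.
Proof.
by exists 1 => y; rewrite mul1r (le_trans (prod_norm_le _))//= normr0 add0r.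
Qed.

Lemma pair_left_bounded :
  exists M : K, forall x, `|@pair_left K V W x| <= M * `|x|.
Proof.
by exists 1 => x; rewrite mul1r (le_trans (prod_norm_le _))//= normr0 addr0.
Qed.

End PairRight.

Section FiniteRank.
Context {R : realType} {H : hilbertType R} {V : normedModType R[i]} {n : nat}.
Variables (g : 'I_n -> H) (v : 'I_n -> V).

Definition finite_rank_op (x : H) : V := \sum_(i < n) hdot x (g i) *: v i.

Let finite_rank_linear : linear finite_rank_op.
Proof.
move=> a x y; rewrite /finite_rank_op scaler_sumr -big_split/=.
by apply: eq_bigr => i _; rewrite hdotDl hdotZl scalerDl scalerA.
Qed.

HB.instance Definition _ :=
  GRing.isLinear.Build R[i] H V *:%R finite_rank_op finite_rank_linear.

Lemma finite_rank_bounded :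
  exists M : R[i], forall x, `|finite_rank_op x| <= M * `|x|.
Proof.
exists (\sum_(i < n) `|g i| * `|v i|) => x; rewrite mulr_suml.
rewrite (le_trans (ler_norm_sum _ _ _))// ler_sum// => i _.
rewrite normrZ mulrAC ler_wpM2r// mulrC; exact: cauchy_schwarz.
Qed.

End FiniteRank.

(** The operator is the orthogonal projection onto [F]: the Gram-Schmidt process
    turns a basis of [F] into [g], and a vector of [F] orthogonal to [g] is
    orthogonal to the basis, hence to itself. *)
Lemma finite_dim_projection (R : realType) (K : hilbertType R) (F : set K) :
  linear_subspace F -> (set_dim F < +oo)%E ->
  exists n (g : 'I_n -> K), (forall y, F (finite_rank_op g g y)) /\
    forall y, F (y - finite_rank_op g g y) -> y - finite_rank_op g g y = 0.
Proof.
move=> subF dimF.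
have [n [f [Ff _ spf _]]] := quotient_dim_fin subspace0 dimF.
(* The process runs on sequences, so the basis is continued by zeros. *)
pose x k := if insub k is Some i then f i else 0.
have xf (i : 'I_n) : x i = f i by rewrite /x valK.
have Fx k : F (x k) by rewrite /x; case: insub => [i|]; [exact: Ff|exact: subF.1].
have Fg k : F (gram_schmidt x k) := gram_schmidt_sub subF Fx k.
exists n, (fun i => gram_schmidt x i); split=> y.
  by apply: (subspace_sum subF) => i; exact: Fg.
set z := y - _ => /spf[a /= /subr0_eq za].
have zg j : (j < n)%N -> hdot z (gram_schmidt x j) = 0.
  by move=> jn; exact: (hdot_residual _ (gram_schmidt_orthogonal x)).
have zf i : hdot z (f i) = 0.
  rewrite -xf; apply: gram_schmidt_eq0 => j ji; apply: zg.
  exact: leq_ltn_trans ji (ltn_ord i).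
apply: hdot_eq0; rewrite {1}za hdot_suml big1// => i _.
by rewrite (hdot_eq0C (zf i)) mulr0.
Qed.

Section FredholmClosedRange.
Context {R : realType} {H K : hilbertType R}.
Variables (A : 'B(H, H)) (B : 'B(K, K)) (C : 'B(K, H)).
Let T : 'B((H * K)%type, (H * K)%type) := upper_triangular_op A B C.

(** Embedded in [H * K], [R(A)] is the image of [H * 0] under [T]; it meets the
    image of [0 * K] in the image of the finite-dimensional space
    [connecting_kernel A B C]. Projecting this space away, and adding the span of
    finitely many vectors that complement [R(T)], gives a complement of [R(A)]
    that is the range of a bounded operator. *)
Lemma fredholm_upper_left_closed :
  separable_space H -> infinite_dimensional H -> fredholm T -> closed (range A).
Proof.
move=> sepH infH [_ nullT defT].
have subF : linear_subspace (connecting_kernel A B C).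
  exact: subspace_connecting_kernel.
have dimF : (set_dim (connecting_kernel A B C) < +oo)%E.
  apply: le_lt_trans nullT; rewrite /T nullity_upper_triangular leeDr//.
  exact: quotient_dim_ge0.
have [m [g [Fg gF]]] := finite_dim_projection subF dimF.
have subT : linear_subspace (range T) by exact/subspace_image/subspaceT.
have [n [v [_ iv spv _]]] := quotient_dim_fin subT defT.
have [h [oh _ _]] := orthonormal_basis_exists sepH subspaceT infH.
(* The coefficients of the [v i] range over an orthonormal family [h] of [H], which
   makes the domain of [G] the Banach space [K * H]. *)
pose A1 : {linear H -> (H * K)%type} := T \o pair_left.
pose P : {linear K -> K} := idfun \- finite_rank_op g g.
pose Q : {linear H -> (H * K)%type} := finite_rank_op (fun i : 'I_n => h i) v.
pose G : {linear (K * H)%type -> (H * K)%type} :=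
  (T \o pair_right \o P \o fst) \+ (Q \o snd).
have TE x y : T (x, y) = T (pair_left x) + T (pair_right y).
  by rewrite -linearD; congr (T _); congr pair; rewrite /= ?addr0 ?add0r.
have bT := @bounded_linearP _ _ _ T.
have bP : exists M : R[i], forall y, `|P y| <= M * `|y|.
  have [M gM] := finite_rank_bounded g g; exists (1 + M) => y.
  rewrite mulrDl mul1r (le_trans (ler_normB _ _))//.
  by apply: lerD => //; exact: gM.
have bQ := finite_rank_bounded (fun i : 'I_n => h i) v.
have bfst : exists M : R[i], forall z : K * H, `|z.1| <= M * `|z|.
  by exists 1 => z; rewrite mul1r; have [] := prod_norm_ge z.
have bsnd : exists M : R[i], forall z : K * H, `|z.2| <= M * `|z|.
  by exists 1 => z; rewrite mul1r; have [] := prod_norm_ge z.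
have : closed (range A1).
  apply: (@complemented_range_closed R H (K * H)%type (H * K)%type A1 G).
  - exact: norm_bounded_comp bT pair_left_bounded.
  - apply: norm_bounded_add; last exact: norm_bounded_comp bQ bsnd.
    apply: norm_bounded_comp bfst; apply: norm_bounded_comp bP.
    exact: norm_bounded_comp bT pair_right_bounded.
  - move=> z; have [a [[x0 y0] _ /esym/eqP]] := spv z Logic.I.
    rewrite subr_eq TE => /eqP ->.
    have [Bq [x1 _ Ax1]] := Fg y0; set q := finite_rank_op g g y0 in Bq Ax1.
    have Tq : T (pair_right q) = T (pair_left x1).
      by congr pair; rewrite /= !linear0 ?add0r ?addr0.
    have -> : T (pair_right y0) = T (pair_right (P y0)) + T (pair_left x1).
      by rewrite -Tq -!linearD subrK.
    exists (x0 + x1), (y0, \sum_(i < n) a i *: h i).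
    have -> : G (y0, \sum_(i < n) a i *: h i) =
        T (pair_right (P y0)) + \sum_(i < n) a i *: v i.
      congr (_ + _); apply: eq_bigr => i _ /=.
      by rewrite hdot_orthonormal_coef.
    have -> : A1 (x0 + x1) = T (pair_left x0) + T (pair_left x1).
      by rewrite linearD.
    by rewrite !addrA; congr (_ + _); rewrite addrAC.
  - move=> x [y w]; set b := G _; move: @b.
    rewrite -[G _]/(T (pair_right (P y)) + Q w) => b Ab.
    have Qw : Q w = 0.
      have : range T (Q w).
        exists (pair_left x - pair_right (P y)) => //.
        have -> : T (pair_left x - pair_right (P y)) =
            A1 x - T (pair_right (P y)) by rewrite linearB.
        by rewrite Ab addrAC subrr add0r.
      by move/iv => w0; apply: big1 => i _; rewrite w0 scale0r.
    move: Ab; rewrite /b Qw addr0 => Ab.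
    have [Ax By] : A x = C (P y) /\ B (P y) = 0.
      move: Ab => [+ +]; rewrite /= !linear0 addr0 add0r => ->.
      by move=> <-.
    suff -> : P y = 0 by rewrite !linear0.
    by apply: gF; split=> //; exists x.
move/closed_adherent => clA1; apply/closed_adherent => z Az.
have [|x _ [Axz]] := clA1 (pair_left z).
  move=> e e0; have [_ [x _ <-] zx] := Az e e0.
  exists (A1 x); first by exists x.
  rewrite (_ : _ - _ = pair_left (z - A x)); last first.
    by congr pair; rewrite /= ?linear0 ?addr0 ?subr0.
  by rewrite (le_lt_trans (prod_norm_le _))//= normr0 addr0.
by exists x => //; rewrite -Axz linear0 addr0.
Qed.

End FredholmClosedRange.

(** * Orthogonal complements and bases indexed by two copies of nat *)

Section SumIndex.
Implicit Types (n : nat) (j : nat + nat).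

Definition parity_decode n : nat + nat :=
  if odd n then inr n./2 else inl n./2.

Definition parity_encode j : nat :=
  match j with inl k => k.*2 | inr k => k.*2.+1 end.

Lemma parity_encodeK : cancel parity_encode parity_decode.
Proof.
by move=> [k|k]; rewrite /parity_decode/= odd_double ?uphalf_double ?doubleK.
Qed.

Lemma parity_decodeK : cancel parity_decode parity_encode.
Proof.
move=> n; rewrite /parity_decode; have := odd_double_half n.
case: odd => /= <-; rewrite ?half_bit_double ?add0n ?add1n//=.
  by rewrite ?uphalf_double ?doubleK.
by rewrite ?uphalf_double ?doubleK.
Qed.

(** Exchanging the tails from [s] on of the first copy and from [t] on of the
    second one realizes an index shift by [s - t] between two infinite bases; as
    an involution it permutes the indices, so that an orthonormal basis remains
    one. *)
Definition swap_tails (s t : nat) j : nat + nat :=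
  match j with
  | inl k => if (k < s)%N then inl k else inr (k - s + t)%N
  | inr k => if (k < t)%N then inr k else inl (k - t + s)%N
  end.

Lemma swap_tailsK s t : involutive (swap_tails s t).
Proof.
move=> [k|k] /=; case: ltnP => /= [->//|le]; rewrite ltnNge leq_addl/= addnK;
  by rewrite subnK.
Qed.

Definition sum_family (T : Type) (e f : nat -> T) j : T :=
  match j with inl k => e k | inr k => f k end.

End SumIndex.

Section OrthogonalComplement.
Context {R : realType} {H : hilbertType R}.
Local Notation "''[' u , v ]" := (hdot u%R v%R) : ring_scope.
Implicit Types (S : set H) (e f : nat -> H).

Definition orthogonal_to e : set H := [set z | forall k, '[z, e k] = 0].

Lemma subspace_orthogonal_to e : linear_subspace (orthogonal_to e).
Proof.
split=> [k|a x y xe ye k]; first by rewrite hdot0l.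
by have [_ /(_ a x y (xe k) (ye k))] := subspace_hdot_eq0 (e k).
Qed.

Section Basis.
Context {S : set H} {e : nat -> H}.
Hypotheses (clS : closed S) (subS : linear_subspace S).
Hypotheses (oe : orthonormal_sequence e) (Se : forall n, S (e n))
  (tote : total_in S e).

Lemma orthogonal_decomposition x : exists2 p, S p & orthogonal_to e (x - p).
Proof. exact: orthogonal_projection. Qed.

(** The projection of [x] onto the closed subspace [S `&` [set y | '[y, z] = 0]],
    which contains [e], has the same coefficients as [x], so it is [x]. *)
Lemma orthogonal_to_perp x z : S x -> orthogonal_to e z -> '[x, z] = 0.
Proof.
move=> Sx ze.
have clSz : closed (S `&` [set y | '[y, z] = 0]).
  by apply: closedI => //; exact: closed_hdot_eq0.
have subSz : linear_subspace (S `&` [set y | '[y, z] = 0]).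
  by apply: subspaceI => //; exact: subspace_hdot_eq0.
have [p [Sp pz] xp] : exists2 p, (S `&` [set y | '[y, z] = 0]) p &
    orthogonal_to e (x - p).
  by apply: orthogonal_projection => // j; split=> //; exact/hdot_eq0C/ze.
suff /subr0_eq -> : x - p = 0 by [].
by apply: tote => //; exact: subspaceB.
Qed.

(** The orthogonal complement of [S] is a set of representatives of the quotient
    by [S]. *)
Lemma set_dim_orthogonal_to : set_dim (orthogonal_to e) = set_codim S.
Proof.
apply: (@quotient_dim_iso R H H idfun (orthogonal_to e) [set 0] setT S) => //.
- exact: subspace_orthogonal_to.
- move=> x xe; split=> [->|Sx]; first exact: subS.1.
  exact: tote.
- move=> y _; have [p Sp yp] := orthogonal_decomposition y.
  by exists (y - p); rewrite ?subKr.
Qed.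

Lemma total_sum_family f : total_in (orthogonal_to e) f ->
  forall x, (forall j, '[x, sum_family e f j] = 0) -> x = 0.
Proof.
move=> totf x xef; apply: totf => k; first exact: xef (inl k).
exact: xef (inr k).
Qed.

(** As [f] is total in the orthogonal complement of [S], [orthogonal_to f] is the
    double complement of the closed subspace [S]. *)
Lemma mem_of_orthogonal_to f x : (forall n, orthogonal_to e (f n)) ->
  total_in (orthogonal_to e) f -> orthogonal_to f x -> S x.
Proof.
move=> fe totf xf; have [p Sp xp] := orthogonal_decomposition x.
suff /subr0_eq -> : x - p = 0 by [].
apply: totf => // n; rewrite hdotBl xf orthogonal_to_perp ?subrr//.
Qed.

End Basis.

Definition orthonormal_sum (w : nat + nat -> H) :=
  forall i j, '[w i, w j] = (i == j)%:R.

Lemma orthonormal_sum_family e f : orthonormal_sequence e ->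
  orthonormal_sequence f -> (forall n, orthogonal_to e (f n)) ->
  orthonormal_sum (sum_family e f).
Proof.
move=> oe of_ fe [i|i] [j|j] /=; rewrite ?oe ?of_//; last exact: fe.
by apply: hdot_eq0C; exact: fe.
Qed.

End OrthogonalComplement.

Lemma isometry_sum_exists (R : realType) (K H : hilbertType R)
    (v : nat + nat -> K) (w : nat + nat -> H) :
  orthonormal_sum v -> (forall x, (forall j, hdot x (v j) = 0) -> x = 0) ->
  orthonormal_sum w -> (forall x, (forall j, hdot x (w j) = 0) -> x = 0) ->
  exists2 U : 'B(K, H), invertible U & forall x j, hdot (U x) (w j) = hdot x (v j).
Proof.
move=> ov totv ow totw.
have inj := can_inj parity_decodeK.
have [||||U invU UE] := @isometry_exists R K H
  (v \o parity_decode) (w \o parity_decode).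
- by move=> i j; rewrite /= ov (inj_eq inj).
- by move=> x _ xv; apply: totv => j; rewrite -(parity_encodeK j); exact: xv.
- by move=> i j; rewrite /= ow (inj_eq inj).
- by move=> x _ xw; apply: totw => j; rewrite -(parity_encodeK j); exact: xw.
by exists U => // x j; rewrite -(parity_encodeK j); exact: UE.
Qed.

Section RangeDimension.
Context {R : realType} {V W : normedModType R[i]}.
Variable T : 'B(V, W).

Lemma set_codim_kernel : set_codim (T @^-1` [set 0]) = set_dim (range T).
Proof.
apply: (@quotient_dim_iso R V W T setT _ (range T) [set 0]) => //.
- exact: subspace0.
- by move=> _ [x _ <-]; exists x => //; rewrite subrr.
Qed.

Lemma rank_nullity : set_dim [set: V] = (set_dim (range T) + nullity T)%E.
Proof.
have subN : linear_subspace (T @^-1` [set 0]).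
  exact/subspace_preimage/subspace0.
rewrite -set_codim_kernel; apply: quotient_dim_add => //; first exact: subspace0.
by move=> _ ->; exact: subN.1.
Qed.

Lemma dim_range_deficiency :
  set_dim [set: W] = (deficiency T + set_dim (range T))%E.
Proof.
apply: quotient_dim_add => //; [exact/subspace_image/subspaceT|exact: subspace0|].
by move=> _ ->; exists 0; rewrite ?linear0.
Qed.

Lemma weyl_of_dims n :
  nullity T = n%:R%:E -> deficiency T = n%:R%:E -> weyl T.
Proof.
move=> nT dT; split; last by rewrite /fredholm_index nT dT -EFinB subrr.
by split; rewrite ?nT ?dT ?ltry//; right; rewrite /lower_semi_fredholm dT ltry.
Qed.

Lemma invertible_fredholm : invertible T -> fredholm T.
Proof.
move=> [S TS ST].
have nT : nullity T = 0%:R%:E.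
  apply: (@quotient_dim_basis _ _ _ _ 0 (fun=> 0)); first exact: subspace0.
  - by case.
  - by move=> ? ? [].
  - move=> x /= Tx; exists (fun=> 0).
    by rewrite big_ord0 subr0 -(TS x) Tx linear0.
have dT : deficiency T = 0%:R%:E.
  apply: (@quotient_dim_basis _ _ _ _ 0 (fun=> 0)).
  - exact/subspace_image/subspaceT.
  - by case.
  - by move=> ? ? [].
  - by move=> y _; exists (fun=> 0); exists (S y) => //; rewrite big_ord0 subr0.
by have [] := weyl_of_dims nT dT.
Qed.

End RangeDimension.

(** * Completion to a Weyl operator *)

Section Completion.
Context {R : realType} {H K : hilbertType R}.
Hypotheses (sepH : separable_space H) (sepK : separable_space K)
  (infH : infinite_dimensional H) (infK : infinite_dimensional K).
Variables (A : 'B(H, H)) (B : 'B(K, K)).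

Lemma isometry_separable : exists U : 'B(K, H), invertible U.
Proof.
have [g [og _ tg]] := orthonormal_basis_exists sepK subspaceT infK.
have [h [oh _ th]] := orthonormal_basis_exists sepH subspaceT infH.
by have [U invU _] := isometry_exists og tg oh th; exists U.
Qed.

(** The isometry [U] maps [N(B)] to the orthogonal complement of [R(A)] except
    for the first [s] vectors of the basis [e], which go into [R(A)]; and it
    leaves the first [t] vectors of the basis [p] of this complement to be reached
    from outside of [N(B)]. So the connecting map has a kernel of dimension [s]
    and a cokernel of dimension [t]. *)
Lemma adapted_completion (s t : nat) : closed (range A) ->
  nullity A = t%:R%:E -> deficiency B = s%:R%:E ->
  nullity B = +oo%E -> deficiency A = +oo%E ->
  exists2 C : 'B(K, H), invertible C & weyl (upper_triangular_op A B C).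
Proof.
move=> clY nA dB nB dA.
set X := B @^-1` [set 0]; set Y := range A in clY.
have subX : linear_subspace X by exact/subspace_preimage/subspace0.
have subY : linear_subspace Y by exact/subspace_image/subspaceT.
have clX : closed X.
  apply/closed_adherent => x Xx; apply/normr0_eq0/le_anti.
  rewrite normr_ge0 andbT; apply/ler_addgt0Pr => d d0; rewrite add0r.
  have [M [M0 BM]] := bounded_norm (@bounded_linearP _ _ _ B).
  have M1 : 0 < M + 1 by rewrite ltr_wpDl.
  have [y /= By xy] := Xx _ (divr_gt0 d0 M1).
  rewrite -[B x]subr0 -By -linearB (le_trans (BM _))//.
  rewrite (le_trans (ler_wpM2l M0 (ltW xy)))// mulrCA ler_piMr ?(ltW d0)//.
  by rewrite ler_pdivrMr// mul1r lerDl.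
have dimY : set_dim Y = +oo%E.
  have := rank_nullity A; rewrite infH nA -/Y.
  by case: (set_dim Y).
have codimX : set_codim X = +oo%E.
  rewrite set_codim_kernel; have := dim_range_deficiency B; rewrite infK dB.
  by case: (set_dim _).
have [e [oe Xe te]] := orthonormal_basis_exists sepK subX nB.
have [q [oq Yq tq]] := orthonormal_basis_exists sepH subY dimY.
have [|f [of_ ef tf]] :=
    orthonormal_basis_exists sepK (subspace_orthogonal_to e).
  by rewrite (set_dim_orthogonal_to clX subX oe Xe te).
have [|p [op qp tp]] :=
    orthonormal_basis_exists sepH (subspace_orthogonal_to q).
  by rewrite (set_dim_orthogonal_to clY subY oq Yq tq).
(* [e] and [f] are bases of [N(B)] and of its complement, [q] and [p] of [R(A)] and
   of its complement. The pairing [v j |-> w j] is: [e i] to [q i] for [i < s],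
   [e (s + k)] to [p (t + k)], [f i] to [p i] for [i < t], and [f (t + k)] to
   [q (s + k)]. *)
pose v := sum_family e f; pose w := sum_family q p \o swap_tails s t.
have ov : orthonormal_sum v by exact: orthonormal_sum_family.
have ow : orthonormal_sum w.
  move=> i j; rewrite /w /= (orthonormal_sum_family oq op qp).
  by rewrite (inj_eq (inv_inj (@swap_tailsK s t))).
have totv x : (forall j, hdot x (v j) = 0) -> x = 0.
  exact: total_sum_family.
have totw x : (forall j, hdot x (w j) = 0) -> x = 0.
  move=> xw; apply: (total_sum_family tp) => j.
  by rewrite -(swap_tailsK s t j); exact: xw.
have [U invU UE] := isometry_sum_exists ov totv ow totw.
have Uv j : U (v j) = w j.
  apply: subr0_eq; apply: totw => i.
  by rewrite hdotBl UE ov ow subrr.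
have Up y k : hdot (U y) (p (k + t)%N) = hdot y (e (k + s)%N).
  have := UE y (inl (k + s)%N).
  by rewrite /w /v /= ltnNge leq_addl/= addnK.
have Uq y k : hdot (U y) (q (k + s)%N) = hdot y (f (k + t)%N).
  have := UE y (inr (k + t)%N).
  by rewrite /w /v /= ltnNge leq_addl/= addnK.
have Upf y k : (k < t)%N -> hdot (U y) (p k) = hdot y (f k).
  by move=> kt; have := UE y (inr k); rewrite /w /v /= kt.
have Ueq k : (k < s)%N -> U (e k) = q k.
  by move=> ks; have := Uv (inl k); rewrite /w /v /= ks.
exists U => //; apply: (@weyl_of_dims _ _ _ _ (t + s)).
- rewrite nullity_upper_triangular nA natrD EFinD; congr (_ + _)%E.
  apply: (@quotient_dim_basis _ _ _ _ _ (fun i : 'I_s => e i)).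
  + exact: subspace0.
  + by move=> i; split; [exact: Xe|rewrite Ueq//; exact: Yq].
  + move=> a ae i; rewrite -(hdot_orthonormal_coef oe a i).
    by rewrite [\sum__ _]ae hdot0l.
  + move=> y [By YUy]; exists (fun i : 'I_s => hdot y (e i)).
    apply: te => [|k].
      by apply: (subspaceB subX) => //; exact: (subspace_sum subX).
    have [ks|sk] := ltnP k s.
      exact: (hdot_residual _ (orthonormal_orthogonal_system oe)).
    rewrite hdotBl (hdot_orthonormal_sum oe (fun i => hdot y (e i))).
    rewrite ltnNge sk subr0 -(subnK sk) -Up.
    exact: (orthogonal_to_perp clY subY oq Yq tq).
- rewrite deficiency_upper_triangular dB addnC natrD EFinD; congr (_ + _)%E.
  have Dp h i : connecting_range A B U h -> (i < t)%N -> hdot h (p i) = 0.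
    move=> [x _ [y By <-]] it; rewrite hdotDl Upf//.
    rewrite (orthogonal_to_perp clY subY oq Yq tq)//; last by exists x.
    by rewrite add0r (orthogonal_to_perp clX subX oe Xe te).
  apply: (@quotient_dim_basis _ _ _ _ _ (fun i : 'I_t => p i)) => //.
  + exact: subspace_connecting_range.
  + by move=> a ap i; rewrite -(hdot_orthonormal_coef op a i) Dp.
  + move=> h _; exists (fun i : 'I_t => hdot h (p i)); set h' := _ - _.
    have h'p i : (i < t)%N -> hdot h' (p i) = 0.
      exact: (hdot_residual _ (orthonormal_orthogonal_system op)).
    have [h0 Yh0 h'h0] := orthogonal_decomposition clY subY oq Yq h'.
    have [V VU UV] := invU; set x := V (h' - h0).
    have Xx : X x.
      apply: (mem_of_orthogonal_to clX subX oe Xe te ef tf) => k.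
      have [kt|tk] := ltnP k t.
        rewrite -Upf// /x UV hdotBl h'p//.
        by rewrite (orthogonal_to_perp clY subY oq Yq tq)// subrr.
      by rewrite -(subnK tk) -Uq /x UV; exact: h'h0.
    have [z _ Az] := Yh0; exists z => //; exists x => //.
    by rewrite Az /x UV addrC subrK.
Qed.

(** If [alpha(B)] is finite, then so are all terms of the two identities for
    [alpha(A) + alpha(B)] and [beta(A) + beta(B)], and the rank of the connecting
    map cancels, whatever the invertible operator. *)
Lemma weyl_completion :
  upper_semi_fredholm A -> lower_semi_fredholm B ->
  (nullity A + nullity B = deficiency A + deficiency B)%E ->
  exists2 C : 'B(K, H), invertible C & weyl (upper_triangular_op A B C).
Proof.
move=> [clA nA] dB index0.
have subA : linear_subspace (range A) by exact/subspace_image/subspaceT.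
have subB : linear_subspace (range B) by exact/subspace_image/subspaceT.
have [t [_ [_ _ _ tE]]] := quotient_dim_fin subspace0 nA.
have [s [_ [_ _ _ sE]]] := quotient_dim_fin subB dB.
have {}tE : nullity A = t%:R%:E := tE.
have {}sE : deficiency B = s%:R%:E := sE.
have [nB|[n [_ [_ _ _ nE]]]] :=
    quotient_dim_spec (B @^-1` [set 0]) (@subspace0 R K).
  have {}nB : nullity B = +oo%E := nB.
  apply: (adapted_completion clA tE sE nB).
  by move: index0; rewrite nB tE sE; case: (deficiency A).
have {}nE : nullity B = n%:R%:E := nE.
have [U invU] := isometry_separable; exists U => //.
have nullB := nullity_lower_right A B U; rewrite nE in nullB.
have defA := deficiency_upper_left A B U.
have subD := subspace_connecting_range A B U.
have subF := subspace_connecting_kernel A B U.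
have dimF : (set_dim (connecting_kernel A B U) < +oo)%E.
  rewrite (le_lt_trans _ (ltry n%:R))// nullB leeDr//; exact: quotient_dim_ge0.
have rankF : (connecting_rank A B U < +oo)%E.
  rewrite (le_lt_trans _ (ltry n%:R))// nullB leeDl//; exact: quotient_dim_ge0.
have dimD : (set_codim (connecting_range A B U) < +oo)%E.
  have : (deficiency A < +oo)%E.
    by move: index0; rewrite nE tE sE; case: (deficiency A) => // x; rewrite ltry.
  apply: le_lt_trans; rewrite defA leeDl//; exact: quotient_dim_ge0.
have [m [_ [_ _ _ mE]]] := quotient_dim_fin subspace0 dimF.
have [r [_ [_ _ _ rE]]] := quotient_dim_fin subF rankF.
have [g [_ [_ _ _ gE]]] := quotient_dim_fin subD dimD.
have {}mE : set_dim (connecting_kernel A B U) = m%:R%:E := mE.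
have {}rE : connecting_rank A B U = r%:R%:E := rE.
have {}gE : set_codim (connecting_range A B U) = g%:R%:E := gE.
have tm : (t + m = s + g)%N.
  move: index0; rewrite defA nE nullB tE sE mE rE gE -!EFinD => -[].
  by rewrite -!natrD => /eqP; rewrite eqr_nat => /eqP; lia.
apply: (@weyl_of_dims _ _ _ _ (t + m)).
- by rewrite nullity_upper_triangular tE mE -EFinD natrD.
- by rewrite deficiency_upper_triangular sE gE -EFinD tm natrD.
Qed.

End Completion.

(** * Necessary conditions and conclusion *)

Section Necessity.
Context {R : realType} {H K : hilbertType R}.
Variables (A : 'B(H, H)) (B : 'B(K, K)) (C : 'B(K, H)).

Lemma weyl_upper_triangular_necessary :
  separable_space H -> infinite_dimensional H ->
  weyl (upper_triangular_op A B C) ->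
  [/\ upper_semi_fredholm A, lower_semi_fredholm B &
      (nullity A + nullity B = deficiency A + deficiency B)%E].
Proof.
move=> sepH infH [fT index0]; have [_ nT dT] := fT.
split; first split.
- exact: fredholm_upper_left_closed fT.
- apply: le_lt_trans nT; rewrite nullity_upper_triangular leeDl//.
  exact: quotient_dim_ge0.
- apply: le_lt_trans dT; rewrite deficiency_upper_triangular leeDl//.
  exact: quotient_dim_ge0.
- rewrite (nullity_lower_right A B C) (deficiency_upper_left A B C).
  rewrite addeCA -nullity_upper_triangular addeAC [X in _ = (X + _)%E]addeC.
  rewrite -deficiency_upper_triangular addeC; congr (_ + _)%E.
  have nT0 : (0 <= nullity (upper_triangular_op A B C))%E := quotient_dim_ge0 _ _.
  have dT0 : (0 <= deficiency (upper_triangular_op A B C))%E := quotient_dim_ge0 _ _.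
  move: index0 nT dT nT0 dT0; rewrite /fredholm_index.
  case: (nullity _) => // x; case: (deficiency _) => // y /= -[].
  by move/subr0_eq ->.
Qed.

End Necessity.

Lemma weyl_ext (R : realType) (V W : normedModType R[i]) (S T : 'B(V, W)) :
  S =1 T -> weyl S -> weyl T.
Proof.
move=> /funext ST.
have nST : nullity S = nullity T by rewrite /nullity ST.
have dST : deficiency S = deficiency T by rewrite /deficiency ST.
move=> [[sS nS dS] iS]; split; last by rewrite /fredholm_index -nST -dST.
split; rewrite -?nST -?dST//.
by right; rewrite /lower_semi_fredholm -dST.
Qed.

Lemma shift_upper_triangular (R : realType) (V W : normedModType R[i])
    (A : 'B(V, V)) (B : 'B(W, W)) (C : 'B(W, V)) (lambda : R[i]) :
  shift_op (upper_triangular_op A B C) lambda =1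
  upper_triangular_op (shift_op A lambda) (shift_op B lambda) C.
Proof. by move=> [x y]; congr pair; rewrite /= addrAC. Qed.

Theorem theorem1 (R : realType) (H K : hilbertType R)
    (sepH : separable_space H) (sepK : separable_space K)
    (infH : infinite_dimensional H) (infK : infinite_dimensional K)
    (A : 'B(H, H)) (B : 'B(K, K)) :
  [/\ \bigcap_(C in [set C : 'B(K, H) | fredholm C])
          sigma_w (upper_triangular_op A B C) =
        \bigcap_(C in [set C : 'B(K, H) | invertible C])
          sigma_w (upper_triangular_op A B C),
      \bigcap_(C in [set C : 'B(K, H) | invertible C])
          sigma_w (upper_triangular_op A B C) =
        \bigcap_(C in [set: 'B(K, H)])
          sigma_w (upper_triangular_op A B C) &
      \bigcap_(C in [set: 'B(K, H)])
          sigma_w (upper_triangular_op A B C) =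
        sigma_SFp A `|` sigma_SFm B `|`
        [set lambda : R[i] |
          (nullity (shift_op A lambda) + nullity (shift_op B lambda))%E <>
          (deficiency (shift_op A lambda) + deficiency (shift_op B lambda))%E]].
Proof.
set capF := \bigcap_(C in [set C : 'B(K, H) | fredholm C]) _.
set capG := \bigcap_(C in [set C : 'B(K, H) | invertible C]) _.
set capB := \bigcap_(C in setT) _.
set S := _ `|` _.
have BF : capB `<=` capF by move=> l Bl C _; exact: Bl.
have FG : capF `<=` capG by move=> l Fl C invC; exact/Fl/invertible_fredholm.
have GS : capG `<=` S.
  move=> l Gl; apply: contrapT => /not_orP[/not_orP[/contrapT uA /contrapT lB]].
  move=> /contrapT index0.
  have [C invC wC] := weyl_completion sepH sepK infH infK uA lB index0.
  apply: (Gl C invC); apply: weyl_ext wC => z.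
  exact/esym/shift_upper_triangular.
have SB : S `<=` capB.
  move=> l Sl C _ /(weyl_ext (shift_upper_triangular A B C l)) wC.
  have [uA lB index0] := weyl_upper_triangular_necessary sepH infH wC.
  by case: Sl => [[]|].
split; apply/seteqP; split=> l.
- exact: FG.
- by move=> /GS/SB/BF.
- by move=> /GS/SB.
- by move=> /BF/FG.
- by move=> /BF/FG/GS.
- exact: SB.
Qed.
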